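(* Let $\mathcal S$ be the step set of any of the 79 quarter-plane models with small steps (see context), let $q(0,0,n)$ be the number of $n$-step walks with steps in $\mathcal S$ that start and end at $(0,0)$ and stay in $\mathbb{Z}_+^2=\{0,1,2,\dots\}^2$, and let $Q(0,0,z)=\sum_{n\ge 0}q(0,0,n)z^n$. Then the smallest positive singularity of $Q(0,0,z)$ is $$z_g=\inf\{z>0: y_2(z)=y_3(z)\},$$ where $y_2(z),y_3(z)$ are the branch points defined in the context.
   Context: Models. A model is given by a step set $\mathcal S\subset\{-1,0,1\}^2\setminus\{(0,0)\}$. The 79 models are the essentially distinct ones in the classification of Bousquet-Mélou and Mishna, i.e. (up to reflection in the diagonal) those such that: (i) $\mathcal S$ contains a step with $i=1$, a step with $i=-1$, a step with $j=1$ and a step with $j=-1$; (ii) $\mathcal S\not\subset\{(i,j): i\ge j\}$ and $\mathcal S\not\subset\{(i,j): j\ge i\}$; (iii) $\mathcal S$ contains at least one of $(1,0),(0,1),(1,1)$. $|\mathcal S|$ is the number of steps. Branch points. Put $\delta_{i,j}=1$ if $(i,j)\in\mathcal S$ and $0$ otherwise, and $\widetilde a(y)=\sum_{j=-1}^{1}\delta_{1,j}y^{j+1}$, $\widetilde b(y)=\sum_{j=-1}^{1}\delta_{0,j}y^{j+1}$, $\widetilde c(y)=\sum_{j=-1}^{1}\delta_{-1,j}y^{j+1}$, $$\widetilde d(y,z)=[\widetilde b(y)-y/z]^2-4\widetilde a(y)\widetilde c(y).$$ The variable $z$ is real. For $z\in(0,1/|\mathcal S|)$, the polynomial $\widetilde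 d(\cdot,z)$ has four roots (one at most being possibly infinite) satisfying $|y_1(z)|<y_2(z)<1<y_3(z)<|y_4(z)|\le\infty$. For $z\ge 1/|\mathcal S|$ the $y_\ell(z)$ denote the continuations of these roots in $z$.
   Formalization: The 5 singular models (all steps with i+j≥0) are not covered: there y1=y2=0 and Q(0,0,z)=1 has no singularity, so the claim fails; the order on (0,1/|S|) is taken as |y1|≤y2, 0<y2<1<y3≤|y4|, so that the model {(±1,±1)} is included. *)

(* Defs.v *)
From Stdlib Require Import Reals ZArith List Bool.
From Coquelicot Require Import Coquelicot.
Import ListNotations.

Open Scope bool_scope.
Open Scope R_scope.

Definition nonzero_small_steps : list (Z * Z) :=
  [(1, 0); (1, 1); (0, 1); (-1, 1); (-1, 0); (-1, -1); (0, -1); (1, -1)]%Z.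

(* A step set is a predicate St on Z * Z.  Every model satisfying these
   conditions is covered, so each of the 79 reflection classes appears through
   all of its representatives. *)
Record is_model (St : Z * Z -> bool) : Prop := {
  small_steps : forall s, St s = true -> In s nonzero_small_steps;
  has_east    : exists j, St (1%Z, j) = true;
  has_west    : exists j, St ((-1)%Z, j) = true;
  has_north   : exists i, St (i, 1%Z) = true;
  has_south   : exists i, St (i, (-1)%Z) = true;
  not_below_diagonal : ~ (forall i j, St (i, j) = true -> (i >= j)%Z);
  not_above_diagonal : ~ (forall i j, St (i, j) = true -> (j >= i)%Z);
  leaves_origin : St (1, 0)%Z = true \/ St (0, 1)%Z = true \/ St (1, 1)%Z = true
}.

Definition step_list (St : Z * Z -> bool) : list (Z * Z) :=
  filter St nonzero_small_steps.

Definition nb_steps (St : Z * Z -> bool) : nat := length (step_list St).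

Fixpoint words {A : Type} (l : list A) (n : nat) : list (list A) :=
  match n with
  | O => [[]]
  | S m => flat_map (fun a => map (cons a) (words l m)) l
  end.

(* The walk w started at (i, j) stays in the quadrant and ends at the origin. *)
Fixpoint returns_to_origin (i j : Z) (w : list (Z * Z)) : bool :=
  ((0 <=? i) && (0 <=? j))%Z &&
  match w with
  | [] => ((i =? 0) && (j =? 0))%Z
  | (k, l) :: w' => returns_to_origin (i + k) (j + l) w'
  end.

Definition q00 (St : Z * Z -> bool) (n : nat) : nat :=
  length (filter (returns_to_origin 0 0) (words (step_list St) n)).

Definition delta (St : Z * Z -> bool) (i j : Z) : C :=
  if St (i, j) then RtoC 1 else RtoC 0.

Open Scope C_scope.

Definition branch_coef (St : Z * Z -> bool) (i : Z) (y : C) : C :=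
  delta St i (-1) + delta St i 0 * y + delta St i 1 * y ^ 2.

Definition a_tilde (St : Z * Z -> bool) (y : C) : C := branch_coef St 1 y.
Definition b_tilde (St : Z * Z -> bool) (y : C) : C := branch_coef St 0 y.
Definition c_tilde (St : Z * Z -> bool) (y : C) : C := branch_coef St (-1) y.

Definition d_tilde (St : Z * Z -> bool) (y : C) (z : R) : C :=
  (b_tilde St y - y / RtoC z) ^ 2 - RtoC 4 * a_tilde St y * c_tilde St y.

Close Scope C_scope.

(* The coefficients of y^4 and y^3 in d_tilde(y, z) are
   delta_{0,1}^2 - 4 delta_{1,1} delta_{-1,1}  and
   - 2 delta_{0,1} / z - 4 (delta_{1,1} delta_{-1,0} + delta_{1,0} delta_{-1,1});
   for every model, the degree in y is thus 4 for all z or 3 for all z.  So the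
   fourth root is either identically infinite (None) or always finite. *)
Definition last_factor (y4 : option (R -> C)) (z : R) (y : C) : C :=
  match y4 with
  | None => RtoC 1
  | Some f => (y - f z)%C
  end.

(* y1, ..., y4 are the roots of d_tilde(., z), with multiplicity, continued
   continuously over z > 0 and labelled through their order on
   0 < z < 1 / nb_steps.
   The order is |y1| < y2 < 1 < y3 < |y4| except for St = {(+-1, +-1)}, where d_tilde
   is even in y and y1 = - y2, y4 = - y3; whence the two weak inequalities.
   The condition 0 < y2, which is implied by |y1| < y2, is then required to keep
   y2 apart from y1.  It fails (y1 = y2 = 0) exactly for the models in which
   i + j >= 0 for all steps; for them q(0,0,n) = 0 for n >= 1 and Q(0,0,z) = 1 has
   no singularity. *)
Record branch_points (St : Z * Z -> bool)
    (y1 y2 y3 : R -> C) (y4 : option (R -> C)) : Prop := {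
  roots_d_tilde : forall z : R, 0 < z ->
    exists k : C, k <> RtoC 0 /\
    forall y : C, d_tilde St y z =
      (k * (y - y1 z) * (y - y2 z) * (y - y3 z) * last_factor y4 z y)%C;
  continuous_y1 : forall z : R, 0 < z -> continuous y1 z;
  continuous_y2 : forall z : R, 0 < z -> continuous y2 z;
  continuous_y3 : forall z : R, 0 < z -> continuous y3 z;
  continuous_y4 : forall f : R -> C, y4 = Some f ->
    forall z : R, 0 < z -> continuous f z;
  initial_order : forall z : R, 0 < z < 1 / INR (nb_steps St) ->
    exists r2 r3 : R, y2 z = RtoC r2 /\ y3 z = RtoC r3 /\
      Cmod (y1 z) <= r2 /\ 0 < r2 /\ r2 < 1 /\ 1 < r3 /\
      (forall f : R -> C, y4 = Some f -> r3 <= Cmod (f z))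
}.

Definition analytic_at (f : C -> C) (c : C) : Prop :=
  exists (a : nat -> C) (r : R), 0 < r /\
    forall z : C, Cmod (z - c)%C < r ->
      @is_pseries C_AbsRing C_NormedModule a (z - c)%C (f z).

(* f is an analytic continuation of the germ sum_n q_n z^n along the subset D of
   the real axis; D is meant to be an interval containing 0. *)
Definition is_continuation (q : nat -> C) (D : R -> Prop) (f : C -> C) : Prop :=
  (exists r : R, 0 < r /\
     forall z : C, Cmod z < r ->
       @is_pseries C_AbsRing C_NormedModule q z (f z)) /\
  (forall t : R, D t -> analytic_at f (RtoC t)).

(* z0 is the first point t > 0 of the real half-line at which the sum of the
   power series, continued analytically along [0, t), is not analytic. *)
Definition smallest_positive_singularity (q : nat -> C) (z0 : R) : Prop :=
  0 < z0 /\
  (exists f : C -> C, is_continuation q (fun t => 0 <= t < z0) f) /\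
  ~ (exists f : C -> C, is_continuation q (fun t => 0 <= t <= z0) f).

(* Main.v *)
(** Write S(x, y) for the step polynomial and m for its minimum over x, y > 0.

    Branch points.  On y > 0 the discriminant factors through
    phi(y) = min_x S(x, y), so its positive roots relevant here are the solutions
    of phi(y) = 1/z.  In logarithmic coordinates phi is convex with a unique
    minimum m at some y*.  For z < 1/m no root lies on the circle |y| = y*, which
    keeps y2 inside and y3 outside; the curves z = 1/phi(y) on either side of y*
    are followed by y2 and y3 and meet at y* when z = 1/m.  Hence zg = 1/m.

    Radius of convergence.  Tilting by the minimiser gives q(0,0,n) <= m^n.
    Conversely, if Q(0,0,z) converged for some z > 1/m, the Green function h of
    the quadrant killed walk would satisfy h(P) >= z sum_s h(P + s).  After
    tilting, log h is superharmonic for a centred walk with a gain log(z m) > 0 per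
    step; iterating n times deep inside the quadrant gains n log(z m), while log h,
    being Lipschitz, loses only o(n): contradiction.

    Pringsheim's theorem then places the first positive singularity at 1/m. *)

Require Import Defs.
From Stdlib Require Import Reals ZArith List.
From Stdlib Require Import Lra Lia Bool Classical ClassicalEpsilon Ranalysis5.
From Coquelicot Require Import Coquelicot.
Import ListNotations.
Open Scope R_scope.

(** * Power series and the Vivanti-Pringsheim theorem *)

(** The labels [y2] and [y3] are fixed only by continuity and by an order valid for small z, so the
    delicate point is that the positive curves z = 1/phi(y) really carry these labels: inside the
    circle the competitor is [y1], outside it is [y4]. Far along either curve z drops below 1/|S|,
    where the order names the root; from there on a swap would need a double root on the curve,
    which the strict descent of phi excludes.

    For the growth rate, periodicity and confinement to a sublattice are harmless: the Green
    function sums over all lengths and is compared only at points that communicate. That sums of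
    steps fill either Z^2 or the even sublattice is a finite check over the 256 step sets. It fails
    when i + j >= 0 for all steps; there 0 would be a double root of the discriminant, which the
    condition 0 < y2 forbids. *)

Fixpoint taylor_coef (t : R) (n k : nat) : R :=
  match n, k with
  | O, O => 1
  | O, S _ => 0
  | S m, O => t * taylor_coef t m O
  | S m, S l => taylor_coef t m l + t * taylor_coef t m (S l)
  end.

(** Equalities arising from series live in a normed-module carrier; [ring] needs their type
    displayed as [C]. *)
Ltac Cring := match goal with |- @eq _ ?x ?y => change (@eq C x y) end; ring.

Lemma Cscal_eq (x y : C) : @scal C_AbsRing C_NormedModule x y = (x * y)%C.
Proof. reflexivity. Qed.

Lemma Cpow_n_eq (x : C) (n : nat) : @pow_n C_AbsRing x n = (x ^ n)%C.
Proof. induction n as [|n IH]; [reflexivity | simpl; rewrite IH; reflexivity]. Qed.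

Definition csum (f : nat -> C) (n : nat) : C := @sum_n C_AbelianMonoid f n.

Lemma csum_O (f : nat -> C) : csum f 0 = f O.
Proof. apply (@sum_O C_AbelianMonoid). Qed.

Lemma csum_ext (f g : nat -> C) (n : nat) :
  (forall k, f k = g k) -> csum f n = csum g n.
Proof. apply (@sum_n_ext C_AbelianMonoid). Qed.

Lemma csum_plus (f g : nat -> C) (n : nat) :
  csum (fun k => f k + g k)%C n = (csum f n + csum g n)%C.
Proof. apply (@sum_n_plus C_AbelianMonoid). Qed.

Lemma csum_Sn (f : nat -> C) (n : nat) :
  csum f (S n) = (csum f n + f (S n))%C.
Proof. apply (@sum_Sn C_AbelianMonoid). Qed.

Lemma csum_mult_l (c : C) (f : nat -> C) (n : nat) :
  csum (fun k => c * f k)%C n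
  = (c * csum f n)%C.
Proof.
  induction n as [|n IH]; [now rewrite ?csum_O, ?sum_O|].
  rewrite !csum_Sn, IH; ring.
Qed.

Lemma csum_shift (f : nat -> C) (n : nat) :
  csum f (S n)
  = (f O + csum (fun k => f (S k)) n)%C.
Proof.
  induction n as [|n IH]; [now rewrite csum_Sn, !csum_O|].
  rewrite csum_Sn, IH, csum_Sn; ring.
Qed.

(** [taylor_coef t n k] is binomial(n, k) t^(n - k), built by Pascal's rule to avoid subtraction on
    nat. It vanishes for k > n, so any upper limit N >= n is allowed. *)
Lemma taylor_binomial (t : R) (h : C) (n N : nat) :
  (n <= N)%nat ->
  csum (fun k => RtoC (taylor_coef t n k) * h ^ k)%C N
  = ((RtoC t + h) ^ n)%C.
Proof.
  revert N; induction n as [|n IH]; intros N HN.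
  - clear HN; induction N as [|N IHN].
    + rewrite csum_O; simpl; ring.
    + rewrite csum_Sn, IHN; simpl; ring.
  - destruct N as [|N]; [lia|].
    rewrite csum_shift.
    pose proof (IH (S N) ltac:(lia)) as E1.
    pose proof (IH N ltac:(lia)) as E2.
    rewrite csum_shift in E1.
    rewrite Cpow_S, Cmult_plus_distr_r.
    rewrite <- E1 at 1; rewrite <- E2.
    rewrite (csum_ext (fun k => RtoC (taylor_coef t (S n) (S k)) * h ^ S k)%C
      (fun k => (h * (RtoC (taylor_coef t n k) * h ^ k))
                + (t * (RtoC (taylor_coef t n (S k)) * h ^ S k)))%C).
    + rewrite csum_plus, !csum_mult_l.
      simpl taylor_coef; rewrite RtoC_mult; ring.
    + intro k; simpl taylor_coef; rewrite RtoC_plus, RtoC_mult; simpl; ring.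
Qed.

Lemma taylor_coef_pos (t : R) (n k : nat) : 0 <= t -> 0 <= taylor_coef t n k.
Proof.
  intro Ht; revert k; induction n as [|n IH]; intros [|k]; simpl; try lra.
  - apply Rmult_le_pos; auto.
  - apply Rplus_le_le_0_compat; [|apply Rmult_le_pos]; auto.
Qed.

Lemma taylor_coef_abs (t : R) (n k : nat) :
  Rabs (taylor_coef t n k) <= taylor_coef (Rabs t) n k.
Proof.
  revert k; induction n as [|n IH]; intros [|k]; simpl.
  - rewrite Rabs_R1; lra.
  - rewrite Rabs_R0; lra.
  - rewrite Rabs_mult; apply Rmult_le_compat_l; auto using Rabs_pos.
  - eapply Rle_trans; [apply Rabs_triang|].
    rewrite Rabs_mult; apply Rplus_le_compat; auto.
    apply Rmult_le_compat_l; auto using Rabs_pos.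
Qed.

Lemma csum_RtoC (f : nat -> R) (n : nat) :
  csum (fun k => RtoC (f k)) n = RtoC (sum_n f n).
Proof.
  induction n as [|n IH]; [now rewrite ?csum_O, ?sum_O|].
  now rewrite csum_Sn, sum_Sn, IH, <- RtoC_plus.
Qed.

Lemma taylor_binomial_R (t h : R) (n N : nat) :
  (n <= N)%nat -> sum_n (fun k => taylor_coef t n k * h ^ k) N = (t + h) ^ n.
Proof.
  intro HN; apply RtoC_inj.
  rewrite <- csum_RtoC, RtoC_pow, RtoC_plus, <- (taylor_binomial t h n N HN).
  apply csum_ext; intro k; now rewrite RtoC_mult, RtoC_pow.
Qed.

Lemma sum_n_pos_mono (g : nat -> R) (K N : nat) :
  (forall n, 0 <= g n) -> (K <= N)%nat -> sum_n g K <= sum_n g N.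
Proof.
  intros Hg HN; induction HN as [|N HN IH]; [lra|].
  rewrite sum_Sn; unfold plus; simpl; specialize (Hg (S N)); lra.
Qed.

Lemma pos_term_le_sum (g : nat -> R) (k N : nat) :
  (forall n, 0 <= g n) -> (k <= N)%nat -> g k <= sum_n g N.
Proof.
  intros Hg HN; eapply Rle_trans; [|apply sum_n_pos_mono; eassumption].
  destruct k as [|k]; [rewrite sum_O; lra|].
  rewrite sum_Sn; unfold plus; simpl.
  assert (0 <= sum_n g k); [|lra].
  clear HN; induction k as [|k IH]; [rewrite sum_O; auto|].
  rewrite sum_Sn; unfold plus; simpl; specialize (Hg (S k)); lra.
Qed.

(** The left side is at most one term of the expansion of (|t| + r)^n, whose terms are all
    nonnegative. *)
Lemma taylor_coef_bound (t r : R) (n k : nat) :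
  0 <= r -> Rabs (taylor_coef t n k) * r ^ k <= (Rabs t + r) ^ n.
Proof.
  intro Hr.
  rewrite <- (taylor_binomial_R (Rabs t) r n (n + k)) by lia.
  apply Rle_trans with (taylor_coef (Rabs t) n k * r ^ k).
  - apply Rmult_le_compat_r; [now apply pow_le | apply taylor_coef_abs].
  - apply (pos_term_le_sum (fun k => taylor_coef (Rabs t) n k * r ^ k)); [|lia].
    intro j; apply Rmult_le_pos; [apply taylor_coef_pos, Rabs_pos | now apply pow_le].
Qed.

Lemma csum_diff_le (f : nat -> C) (g : nat -> R) (K N : nat) :
  (forall n, Cmod (f n) <= g n) -> (K <= N)%nat ->
  Cmod (csum f N - csum f K)%C
  <= sum_n g N - sum_n g K.
Proof.
  intros Hf HN; induction HN as [|N HN IH].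
  - unfold Cminus; rewrite Cplus_opp_r, Cmod_0; lra.
  - rewrite csum_Sn, sum_Sn; unfold plus; simpl.
    replace (csum f N + f (S N) - csum f K)%C
      with ((csum f N - csum f K) + f (S N))%C by ring.
    eapply Rle_trans; [apply Cmod_triangle|]; specialize (Hf (S N)); lra.
Qed.

Lemma is_series_C_lim (f : nat -> C) (l : C) :
  @is_series C_AbsRing C_NormedModule f l <->
  is_lim_seq (fun n => Cmod (l - csum f n)%C) 0.
Proof.
  split.
  - intro H; apply is_lim_seq_spec; intro eps.
    destruct (proj1 (filterlim_locally_ball_norm _ _) H eps) as [N HN].
    exists N; intros n Hn; specialize (HN n Hn).
    unfold ball_norm in HN.
    rewrite Rminus_0_r, Rabs_pos_eq by apply Cmod_ge_0.
    rewrite <- Cmod_opp.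
    replace (- (l - csum f n))%C with (csum f n - l)%C by ring.
    exact HN.
  - intro H; apply is_lim_seq_spec in H.
    apply filterlim_locally_ball_norm; intro eps.
    destruct (H eps) as [N HN]; exists N; intros n Hn; specialize (HN n Hn).
    rewrite Rminus_0_r, Rabs_pos_eq in HN by apply Cmod_ge_0.
    unfold ball_norm.
    rewrite <- Cmod_opp in HN.
    replace (- (l - csum f n))%C with (csum f n - l)%C in HN by ring.
    exact HN.
Qed.

Lemma is_series_Re (f : nat -> C) (l : C) :
  @is_series C_AbsRing C_NormedModule f l -> is_series (fun n => Re (f n)) (Re l).
Proof.
  intro H; apply is_series_C_lim, is_lim_seq_spec in H.
  apply filterlim_locally_ball_norm; intro eps.
  destruct (H eps) as [N HN]; exists N; intros n Hn; specialize (HN n Hn).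
  rewrite Rminus_0_r, Rabs_pos_eq in HN by apply Cmod_ge_0.
  assert (E : sum_n (fun k => Re (f k)) n = Re (csum f n)).
  { clear; induction n as [|n IH]; [now rewrite ?csum_O, ?sum_O|].
    now rewrite sum_Sn, IH, csum_Sn. }
  change (Rabs (sum_n (fun k => Re (f k)) n - Re l) < eps).
  rewrite E.
  rewrite Rabs_minus_sym.
  eapply Rle_lt_trans; [|exact HN].
  eapply Rle_trans; [|apply (re_le_Cmod (l - csum f n)%C)].
  unfold Re, Cminus, Cplus, Copp; simpl; right; reflexivity.
Qed.

Lemma is_series_RtoC (f : nat -> R) (l : R) :
  is_series f l -> @is_series C_AbsRing C_NormedModule (fun n => RtoC (f n)) (RtoC l).
Proof.
  intro H; apply is_series_C_lim.
  apply (is_lim_seq_ext (fun n => Rabs (l - sum_n f n))).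
  - intro n; rewrite csum_RtoC, <- RtoC_minus; now rewrite Cmod_R.
  - replace 0 with (Rabs (l - l)) by (rewrite Rminus_diag; apply Rabs_R0).
    apply (is_lim_seq_abs _ (l - l)), is_lim_seq_minus'; [apply is_lim_seq_const | exact H].
Qed.

Lemma is_series_pos_ge (g : nat -> R) (G : R) (N : nat) :
  (forall n, 0 <= g n) -> is_series g G -> sum_n g N <= G.
Proof.
  intros Hg H; apply (is_lim_seq_incr_compare (sum_n g)); [exact H|].
  intro n; apply sum_n_pos_mono; auto.
Qed.

Lemma is_series_norm_le_tail (f : nat -> C) (L : C) (g : nat -> R) (G : R) (K : nat) :
  @is_series C_AbsRing C_NormedModule f L -> is_series g G ->
  (forall n, Cmod (f n) <= g n) -> (forall n, (n <= K)%nat -> f n = RtoC 0) ->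
  Cmod L <= G - sum_n g K.
Proof.
  intros HL HG Hf H0; apply is_series_C_lim in HL.
  assert (Hg : forall n, 0 <= g n).
  { intro n; eapply Rle_trans; [apply Cmod_ge_0 | apply Hf]. }
  assert (EK : csum f K = RtoC 0).
  { clear -H0; induction K as [|K IH]; [rewrite csum_O; auto|].
    rewrite csum_Sn, IH, H0; [ring | lia | intros n Hn; apply H0; lia]. }
  apply le_epsilon; intros eps Heps.
  apply is_lim_seq_spec in HL.
  destruct (HL (mkposreal eps Heps)) as [N HN].
  specialize (HN (N + K)%nat ltac:(lia)); simpl in HN.
  rewrite Rminus_0_r, Rabs_pos_eq in HN by apply Cmod_ge_0.
  pose proof (csum_diff_le f g K (N + K) Hf ltac:(lia)) as HD.
  pose proof (is_series_pos_ge g G (N + K) Hg HG) as HS.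
  rewrite EK in HD.
  replace L with ((L - csum f (N + K)) + (csum f (N + K) - 0))%C by ring.
  eapply Rle_trans; [apply Cmod_triangle|]; lra.
Qed.

Lemma taylor_coef_series (a : nat -> R) (t r : R) (k : nat) :
  0 < r -> ex_series (fun n => Rabs (a n) * (Rabs t + r) ^ n) ->
  ex_series (fun n => a n * taylor_coef t n k).
Proof.
  intros Hr H.
  apply (@ex_series_le R_AbsRing R_CompleteNormedModule _
           (fun n => / r ^ k * (Rabs (a n) * (Rabs t + r) ^ n)));
    [|exact (ex_series_scal_l (V := R_NormedModule) (/ r ^ k) _ H)].
  intro n; change (Rabs (a n * taylor_coef t n k)
                   <= / r ^ k * (Rabs (a n) * (Rabs t + r) ^ n)).
  rewrite Rabs_mult.
  assert (Hk : 0 < r ^ k) by now apply pow_lt.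
  apply Rmult_le_reg_l with (r ^ k); [assumption|].
  rewrite <- (Rmult_assoc (r ^ k) (/ r ^ k)), Rinv_r, Rmult_1_l by lra.
  pose proof (taylor_coef_bound t r n k ltac:(lra)) as HB.
  pose proof (Rmult_le_compat_l _ _ _ (Rabs_pos (a n)) HB); lra.
Qed.

(** The k-th Taylor coefficient at t of sum a_n z^n, read off by expanding each z^n around t. *)
Definition recentred (a : nat -> R) (t : R) (k : nat) : R :=
  Series (fun n => a n * taylor_coef t n k).

(** No double series is summed. The first K + 1 recentred terms are finitely many series in n, so
    they add up termwise; the error is the sum over n of a_n times (t + h)^n minus its expansion cut
    at K. Its terms vanish for n <= K and are dominated by |a_n| (|t| + r)^n, so the error is at
    most a tail of a convergent series. *)
Lemma recentred_is_pseries (a : nat -> R) (t r : R) (h L : C) :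
  0 < r -> Cmod h <= r ->
  ex_series (fun n => Rabs (a n) * (Rabs t + r) ^ n) ->
  @is_pseries C_AbsRing C_NormedModule (fun n => RtoC (a n)) (RtoC t + h)%C L ->
  @is_pseries C_AbsRing C_NormedModule (fun k => RtoC (recentred a t k)) h L.
Proof.
  intros Hr Hh Hex HL.
  set (g := fun n => Rabs (a n) * (Rabs t + r) ^ n) in *.
  destruct Hex as [G HG].
  assert (Hterm : forall n k,
    Cmod (RtoC (taylor_coef t n k) * h ^ k)%C <= taylor_coef (Rabs t) n k * r ^ k).
  { intros n k; rewrite Cmod_mult, Cmod_R, Cmod_pow.
    apply Rmult_le_compat; auto using Rabs_pos, taylor_coef_abs.
    - apply pow_le, Cmod_ge_0.
    - apply pow_incr; split; [apply Cmod_ge_0 | assumption]. }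
  assert (Hpart : forall K, @is_series C_AbsRing C_NormedModule
    (fun n => RtoC (a n) * csum
                (fun k => RtoC (taylor_coef t n k) * h ^ k) K)%C
    (csum (fun k => h ^ k * RtoC (recentred a t k)) K)%C).
  { assert (H1 : forall k, @is_series C_AbsRing C_NormedModule
      (fun n => RtoC (a n) * (RtoC (taylor_coef t n k) * h ^ k))%C
      (h ^ k * RtoC (recentred a t k))%C).
    { intro k.
      apply is_series_ext with
        (fun n => scal (h ^ k)%C (RtoC (a n * taylor_coef t n k))).
      - intro n; rewrite Cscal_eq, RtoC_mult; Cring.
      - apply (is_series_scal (V := C_NormedModule)), is_series_RtoC, Series_correct.
        apply taylor_coef_series with r; [assumption | now exists G]. }
    induction K as [|K IH].
    - rewrite csum_O; eapply is_series_ext; [|apply (H1 O)].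
      intro n; now rewrite csum_O.
    - rewrite csum_Sn.
      eapply is_series_ext; [|apply (is_series_plus _ _ _ _ IH (H1 (S K)))].
      intro n; rewrite csum_Sn; change (@plus C_NormedModule) with Cplus. Cring. }
  apply is_series_C_lim.
  apply is_lim_seq_le_le with (fun _ => 0) (fun K => G - sum_n g K).
  - intro K; split; [apply Cmod_ge_0|].
    rewrite (csum_ext _ (fun k => h ^ k * RtoC (recentred a t k))%C)
      by (intro k; now rewrite Cpow_n_eq, Cscal_eq).
    apply is_series_norm_le_tail with
      (fun n => RtoC (a n) * (RtoC t + h) ^ n
         - RtoC (a n) * csum
                (fun k => RtoC (taylor_coef t n k) * h ^ k) K)%C.
    + apply (is_series_minus (V := C_NormedModule)); [|apply Hpart].
      eapply is_series_ext; [|exact HL].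
      intro n; simpl; rewrite Cpow_n_eq, Cscal_eq; apply Cmult_comm.
    + exact HG.
    + intro n; unfold g.
      rewrite <- (taylor_binomial t h n (n + K)) by lia.
      rewrite <- (taylor_binomial_R (Rabs t) r n (n + K)) by lia.
      match goal with |- Cmod ?x <= _ =>
        replace x with (RtoC (a n) * (csum
                (fun k => RtoC (taylor_coef t n k) * h ^ k) (n + K)
          - csum
                (fun k => RtoC (taylor_coef t n k) * h ^ k) K))%C by ring end.
      rewrite Cmod_mult, Cmod_R.
      apply Rmult_le_compat_l; [apply Rabs_pos|].
      eapply Rle_trans; [apply csum_diff_le; [apply Hterm | lia]|].
      assert (0 <= sum_n (fun k => taylor_coef (Rabs t) n k * r ^ k) K); [|lra].
      eapply Rle_trans;
        [|apply (pos_term_le_sum (fun k => taylor_coef (Rabs t) n k * r ^ k) 0); [|lia]].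
      * apply Rmult_le_pos; [apply taylor_coef_pos, Rabs_pos | simpl; lra].
      * intro k; apply Rmult_le_pos;
          [apply taylor_coef_pos, Rabs_pos | apply pow_le; lra].
    + intros n Hn; rewrite (taylor_binomial t h n K Hn); ring.
  - apply is_lim_seq_const.
  - replace 0 with (G - G) by ring.
    apply is_lim_seq_minus'; [apply is_lim_seq_const | exact HG].
Qed.

Lemma recentred_is_series (a : nat -> R) (t r h L : R) :
  0 < r -> Rabs h <= r ->
  ex_series (fun n => Rabs (a n) * (Rabs t + r) ^ n) ->
  is_series (fun n => a n * (t + h) ^ n) L ->
  is_series (fun k => recentred a t k * h ^ k) L.
Proof.
  intros Hr Hh Hex HL.
  assert (HC : @is_pseries C_AbsRing C_NormedModule
                 (fun k => RtoC (recentred a t k)) (RtoC h) (RtoC L)).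
  { apply recentred_is_pseries with r; auto; [now rewrite Cmod_R|].
    eapply is_series_ext; [|apply (is_series_RtoC _ _ HL)].
    intro n; simpl; rewrite Cpow_n_eq, Cscal_eq, <- RtoC_plus, RtoC_mult, RtoC_pow.
    apply Cmult_comm. }
  apply is_series_Re in HC.
  eapply is_series_ext; [|exact HC].
  intro n; cbv beta; rewrite Cpow_n_eq, Cscal_eq, <- RtoC_pow, <- RtoC_mult; apply Rmult_comm.
Qed.

Lemma CV_radius_ge (a : nat -> R) (R1 rho : R) :
  (forall x, 0 < x < R1 -> ex_series (fun n => a n * x ^ n)) ->
  0 <= rho < R1 -> Rbar_lt rho (CV_radius a).
Proof.
  intros H Hrho.
  destruct (Rbar_lt_le_dec rho (CV_radius a)) as [|Hle]; [assumption|exfalso].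
  set (x := (rho + R1) / 2).
  apply (CV_disk_outside a x).
  - eapply Rbar_le_lt_trans; [exact Hle|].
    simpl; rewrite Rabs_pos_eq; unfold x; lra.
  - apply ex_series_lim_0, H; unfold x; lra.
Qed.

Lemma ex_series_abs_inside (a : nat -> R) (R1 rho : R) :
  (forall x, 0 < x < R1 -> ex_series (fun n => a n * x ^ n)) ->
  0 <= rho < R1 -> ex_series (fun n => Rabs (a n) * rho ^ n).
Proof.
  intros H Hrho.
  apply (ex_series_ext (fun n => Rabs (a n * rho ^ n))).
  - intro n; rewrite Rabs_mult, (Rabs_pos_eq (rho ^ n)); [reflexivity|].
    apply pow_le; lra.
  - apply CV_disk_inside; rewrite Rabs_pos_eq by lra.
    now apply CV_radius_ge with R1.
Qed.

(** Values on one side suffice, because the sum is continuous at 0 and equals a_0 there. *)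
Lemma power_series_zero_0 (a : nat -> R) (r : R) :
  0 < r -> (forall h, 0 < h < r -> is_series (fun n => a n * h ^ n) 0) -> a O = 0.
Proof.
  intros Hr H.
  assert (Hc : continuity_pt (PSeries a) 0).
  { apply PSeries_continuity; rewrite Rabs_R0.
    apply CV_radius_ge with r; [|lra].
    intros x Hx; exists 0; auto. }
  destruct (Req_dec (a O) 0) as [|Ha]; [assumption|exfalso].
  destruct (Hc (Rabs (a O))) as [d [Hd Hlim]]; [now apply Rabs_pos_lt|].
  set (h := Rmin (d / 2) (r / 2)).
  assert (Hh : 0 < h /\ h < d /\ h < r).
  { unfold h; pose proof (Rmin_l (d / 2) (r / 2)); pose proof (Rmin_r (d / 2) (r / 2)).
    split; [apply Rmin_glb_lt|]; lra. }
  specialize (Hlim h); simpl in Hlim; unfold R_dist in Hlim.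
  rewrite PSeries_0 in Hlim.
  replace (PSeries a h) with 0 in Hlim.
  - rewrite Rminus_0_l, Rabs_Ropp in Hlim.
    apply (Rlt_irrefl (Rabs (a O))), Hlim; split.
    + unfold D_x, no_cond; split; [trivial|lra].
    + rewrite Rminus_0_r, Rabs_pos_eq; lra.
  - symmetry; apply is_series_unique, H; lra.
Qed.

Lemma power_series_zero (a : nat -> R) (r : R) (n : nat) :
  0 < r -> (forall h, 0 < h < r -> is_series (fun n => a n * h ^ n) 0) -> a n = 0.
Proof.
  intros Hr; revert a; induction n as [|n IH]; intros a H.
  - now apply power_series_zero_0 with r.
  - apply (IH (fun k => a (S k))); intros h Hh.
    pose proof (power_series_zero_0 a r Hr H) as H0.
    assert (E : is_series (fun k => a (S k) * h ^ S k) 0).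
    { apply (is_series_incr_1 (fun k => a k * h ^ k)).
      rewrite H0, Rmult_0_l.
      unfold plus; simpl; rewrite Rplus_0_l; auto. }
    apply (is_series_scal_l (/ h)) in E.
    unfold scal in E; simpl in E; unfold mult in E; simpl in E.
    rewrite Rmult_0_r in E.
    eapply is_series_ext; [|exact E].
    intro k; simpl; field; lra.
Qed.

Lemma power_series_unique_right (a b : nat -> R) (F : R -> R) (r : R) :
  0 < r -> (forall h, 0 < h < r -> is_series (fun n => a n * h ^ n) (F h)) ->
  (forall h, 0 < h < r -> is_series (fun n => b n * h ^ n) (F h)) ->
  forall n, a n = b n.
Proof.
  intros Hr Ha Hb n.
  apply Rminus_diag_uniq.
  apply (power_series_zero (fun k => a k - b k) r n Hr); intros h Hh.
  rewrite <- (Rminus_diag (F h)).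
  eapply is_series_ext; [|apply (is_series_minus _ _ _ _ (Ha h Hh) (Hb h Hh))].
  intro k; unfold plus, opp; simpl; ring.
Qed.

Lemma power_series_unique_left (a b : nat -> R) (F : R -> R) (r : R) :
  0 < r -> (forall h, - r < h < 0 -> is_series (fun n => a n * h ^ n) (F h)) ->
  (forall h, - r < h < 0 -> is_series (fun n => b n * h ^ n) (F h)) ->
  forall n, a n = b n.
Proof.
  intros Hr Ha Hb n.
  assert (Hpow : forall k h, (-1) ^ k * (h ^ k) = (- h) ^ k).
  { intros k h; rewrite <- Rpow_mult_distr; f_equal; ring. }
  assert (E : a n * (-1) ^ n = b n * (-1) ^ n).
  { apply (power_series_unique_right (fun k => a k * (-1) ^ k)
             (fun k => b k * (-1) ^ k) (fun h => F (- h)) r Hr); intros h Hh.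
    - eapply is_series_ext; [|apply (Ha (- h)); lra].
      intro k; simpl; rewrite <- Hpow; ring.
    - eapply is_series_ext; [|apply (Hb (- h)); lra].
      intro k; simpl; rewrite <- Hpow; ring. }
  apply Rmult_eq_reg_r with ((-1) ^ n); [exact E|].
  apply pow_nonzero; lra.
Qed.

(** * Identity theorem for real analytic functions *)

Definition real_analytic_at (g : R -> R) (t : R) : Prop :=
  exists (a : nat -> R) (r : R), 0 < r /\
    forall h, Rabs h < r -> is_series (fun n => a n * h ^ n) (g (t + h)).

Lemma real_analytic_left_extend (F G : R -> R) (t d : R) :
  0 < d -> real_analytic_at F t -> real_analytic_at G t ->
  (forall s, t - d < s < t -> F s = G s) ->
  exists e, 0 < e /\ forall s, t - e < s < t + e -> F s = G s.
Proof.
  intros Hd [a [ra [Hra Ha]]] [b [rb [Hrb Hb]]] HFG.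
  set (e := Rmin d (Rmin ra rb)).
  assert (He : 0 < e /\ e <= d /\ e <= ra /\ e <= rb).
  { unfold e; pose proof (Rmin_l d (Rmin ra rb)); pose proof (Rmin_r d (Rmin ra rb)).
    pose proof (Rmin_l ra rb); pose proof (Rmin_r ra rb).
    split; [repeat apply Rmin_glb_lt; assumption | lra]. }
  exists e; split; [lra|]; intros s Hs.
  assert (Eab : forall n, a n = b n).
  { apply power_series_unique_left with (fun h => F (t + h)) e; [lra| |].
    - intros h Hh; apply Ha; apply Rabs_def1; lra.
    - intros h Hh; rewrite HFG by lra; apply Hb; apply Rabs_def1; lra. }
  assert (Es : t + (s - t) = s) by ring.
  rewrite <- Es, <- (is_series_unique _ _ (Ha (s - t) ltac:(apply Rabs_def1; lra))).
  rewrite <- (is_series_unique _ _ (Hb (s - t) ltac:(apply Rabs_def1; lra))).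
  apply Series_ext; intro n; now rewrite Eab.
Qed.

(** Connectedness of the interval: if T is the supremum of the u with agreement on [0, u),
    analyticity at T pushes the agreement past T. *)
Lemma real_analytic_identity (F G : R -> R) (Z r0 : R) :
  0 < r0 -> (forall t, 0 <= t < Z -> real_analytic_at F t) ->
  (forall t, 0 <= t < Z -> real_analytic_at G t) ->
  (forall t, 0 <= t < r0 -> F t = G t) ->
  forall t, 0 <= t < Z -> F t = G t.
Proof.
  intros Hr0 HF HG H0.
  set (E := fun u => u < Z /\ forall s, 0 <= s < u -> F s = G s).
  intros t Ht; apply NNPP; intro Hneq.
  assert (HE0 : forall u, E u -> u <= t).
  { intros u [HuZ Hu]; destruct (Rle_lt_dec u t) as [|Hlt]; [assumption|].
    exfalso; apply Hneq, Hu; lra. }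
  assert (HEr : E (Rmin r0 t)).
  { split; [pose proof (Rmin_r r0 t); lra|].
    intros s Hs; apply H0; pose proof (Rmin_l r0 t); lra. }
  destruct (completeness E) as [T [HT1 HT2]].
  { exists t; exact HE0. }
  { eexists; exact HEr. }
  assert (HTt : T <= t) by (apply HT2; exact HE0).
  assert (Htr : r0 <= t).
  { destruct (Rle_lt_dec r0 t) as [|Hlt]; [assumption|].
    exfalso; apply Hneq, H0; lra. }
  assert (HTr : r0 <= T).
  { apply HT1; rewrite Rmin_left in HEr by lra; exact HEr. }
  assert (Hbelow : forall s, 0 <= s < T -> F s = G s).
  { intros s Hs; apply NNPP; intro Hn.
    assert (T <= s); [|lra].
    apply HT2; intros u [HuZ Hu]; destruct (Rle_lt_dec u s) as [|Hlt]; [assumption|].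
    exfalso; apply Hn, Hu; lra. }
  (* The left neighbourhood used is all of (0, T), hence the width T. *)
  destruct (real_analytic_left_extend F G T T) as [e [He HFG]];
    [lra | apply HF; lra | apply HG; lra | intros s Hs; apply Hbelow; lra |].
  set (u := Rmin (T + e) ((T + Z) / 2)).
  assert (Hu : E u).
  { split.
    - unfold u; pose proof (Rmin_r (T + e) ((T + Z) / 2)); lra.
    - intros s Hs; destruct (Rlt_le_dec s T); [apply Hbelow; lra|].
      apply HFG; unfold u in Hs; pose proof (Rmin_l (T + e) ((T + Z) / 2)); lra. }
  apply HT1 in Hu.
  assert (T < u) by (unfold u; apply Rmin_glb_lt; lra).
  lra.
Qed.

Lemma analytic_at_Re (f : C -> C) (t : R) :
  analytic_at f (RtoC t) -> real_analytic_at (fun s => Re (f (RtoC s))) t.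
Proof.
  intros [a [r [Hr H]]].
  exists (fun n => Re (a n)), r; split; [assumption|]; intros h Hh.
  assert (E : (RtoC (t + h) - RtoC t)%C = RtoC h) by (rewrite RtoC_plus; ring).
  specialize (H (RtoC (t + h))); rewrite E in H.
  specialize (H ltac:(now rewrite Cmod_R)).
  apply is_series_Re in H; eapply is_series_ext; [|exact H].
  intro n; cbv beta; rewrite Cpow_n_eq, Cscal_eq, <- RtoC_pow.
  unfold Re, Cmult, RtoC; simpl; ring.
Qed.

(** The heart of Pringsheim's argument: with nonnegative terms a finite block of the double sum can
    be reordered, so every partial sum at t + h is bounded by the recentred sum B, without prior
    convergence at t + h. *)
Lemma recentred_positive_bound (q : nat -> R) (t h B : R) :
  (forall n, 0 <= q n) -> 0 <= t -> 0 <= h ->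
  (forall k, ex_series (fun n => q n * taylor_coef t n k)) ->
  is_series (fun k => recentred q t k * h ^ k) B ->
  ex_series (fun n => q n * (t + h) ^ n).
Proof.
  intros Hq Ht Hh Hex HB.
  assert (Hqt : forall n k, 0 <= q n * taylor_coef t n k).
  { intros n k; apply Rmult_le_pos; [apply Hq | now apply taylor_coef_pos]. }
  assert (Hrec : forall k N, sum_n (fun n => q n * taylor_coef t n k) N <= recentred q t k).
  { intros k N; apply is_series_pos_ge; [auto | apply Series_correct, Hex]. }
  assert (Hrp : forall k, 0 <= recentred q t k * h ^ k).
  { intro k; apply Rmult_le_pos; [|now apply pow_le].
    eapply Rle_trans; [|apply (Hrec k O)]; rewrite sum_O; auto. }
  assert (Hbound : forall N, sum_n (fun n => q n * (t + h) ^ n) N <= B).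
  { intro N.
    rewrite (sum_n_ext_loc _
      (fun n => sum_n (fun k => q n * taylor_coef t n k * h ^ k) N)).
    - rewrite (sum_n_switch (fun n k => q n * taylor_coef t n k * h ^ k) N N).
      eapply Rle_trans; [|apply (is_series_pos_ge _ B N Hrp HB)].
      rewrite !sum_n_Reals; apply sum_Rle; intros k _.
      rewrite (sum_n_mult_r (K := R_Ring) (h ^ k)).
      apply Rmult_le_compat_r; [now apply pow_le | apply Hrec].
    - intros n Hn; rewrite <- (taylor_binomial_R t h n N Hn).
      rewrite <- (sum_n_mult_l (K := R_Ring) (q n)).
      apply sum_n_ext; intro k; unfold mult; simpl; ring. }
  apply ex_finite_lim_seq_incr with B; [|exact Hbound].
  intro n; rewrite sum_Sn; unfold plus; simpl.
  assert (0 <= q (S n) * (t + h) ^ S n); [|simpl in *; lra].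
  apply Rmult_le_pos; [apply Hq | apply pow_le; lra].
Qed.

(** Chosen by [epsilon] to obtain a total function on [C]; its value is meaningful only where the
    series converges. *)
Definition power_sum (q : nat -> R) (z : C) : C :=
  epsilon (inhabits (RtoC 0))
    (@is_pseries C_AbsRing C_NormedModule (fun n => RtoC (q n)) z).

Lemma power_sum_spec (q : nat -> R) (Z : R) (z : C) :
  (forall x, 0 < x < Z -> ex_series (fun n => q n * x ^ n)) -> Cmod z < Z ->
  @is_pseries C_AbsRing C_NormedModule (fun n => RtoC (q n)) z (power_sum q z).
Proof.
  intros H Hz; unfold power_sum; apply epsilon_spec.
  apply (@ex_series_le C_AbsRing C_CompleteNormedModule _
           (fun n => Rabs (q n) * Cmod z ^ n)).
  - intro n; rewrite Cpow_n_eq.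
    change (Cmod (z ^ n * RtoC (q n)) <= Rabs (q n) * Cmod z ^ n).
    rewrite Cmod_mult, Cmod_R, Cmod_pow; lra.
  - apply ex_series_abs_inside with Z; [assumption|].
    split; [apply Cmod_ge_0 | assumption].
Qed.

Lemma power_sum_analytic (q : nat -> R) (Z t : R) :
  (forall x, 0 < x < Z -> ex_series (fun n => q n * x ^ n)) -> Rabs t < Z ->
  analytic_at (power_sum q) (RtoC t).
Proof.
  intros H Ht.
  exists (fun k => RtoC (recentred q t k)), (Z - Rabs t); split; [lra|].
  intros z Hz.
  pose proof (Cmod_ge_0 (z - RtoC t)%C) as H0; pose proof (Rabs_pos t) as H1.
  apply recentred_is_pseries with ((Cmod (z - RtoC t)%C + (Z - Rabs t)) / 2); [lra|lra| |].
  - apply ex_series_abs_inside with Z; [assumption | lra].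
  - replace (RtoC t + (z - RtoC t))%C with z by ring.
    apply power_sum_spec with Z; [assumption|].
    replace z with (RtoC t + (z - RtoC t))%C by ring.
    eapply Rle_lt_trans; [apply Cmod_triangle|]; rewrite Cmod_R; lra.
Qed.

Theorem vivanti_pringsheim (q : nat -> R) (Z : R) :
  (forall n, 0 <= q n) -> 0 < Z ->
  (forall x, 0 < x < Z -> ex_series (fun n => q n * x ^ n)) ->
  (forall x, Z < x -> ~ ex_series (fun n => q n * x ^ n)) ->
  smallest_positive_singularity (fun n => RtoC (q n)) Z.
Proof.
  intros Hq HZ Hin Hout; split; [assumption|]; split.
  - exists (power_sum q); split.
    + exists Z; split; [assumption|]; intros z Hz; now apply power_sum_spec with Z.
    + intros t Ht; apply power_sum_analytic with Z; [assumption|].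
      rewrite Rabs_pos_eq; lra.
  - intros [f [[r0 [Hr0 Hf0]] Hf]].
    set (G := fun s => Re (power_sum q (RtoC s))).
    set (F := fun s => Re (f (RtoC s))).
    assert (HGs : forall s, 0 <= s < Z -> is_series (fun n => q n * s ^ n) (G s)).
    { intros s Hs.
      pose proof (power_sum_spec q Z (RtoC s) Hin
                    ltac:(rewrite Cmod_R, Rabs_pos_eq; lra)) as HS.
      apply is_series_Re in HS; eapply is_series_ext; [|exact HS].
      intro n; cbv beta; rewrite Cpow_n_eq, Cscal_eq, <- RtoC_pow, <- RtoC_mult.
      apply Rmult_comm. }
    assert (HFG : forall t, 0 <= t < Z -> F t = G t).
    { apply real_analytic_identity with (Rmin r0 Z).
      - now apply Rmin_glb_lt.
      - intros t Ht; apply analytic_at_Re, Hf; lra.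
      - intros t Ht; apply analytic_at_Re, power_sum_analytic with Z; [assumption|].
        rewrite Rabs_pos_eq; lra.
      - intros t Ht; pose proof (Rmin_l r0 Z); pose proof (Rmin_r r0 Z).
        pose proof (Hf0 (RtoC t) ltac:(rewrite Cmod_R, Rabs_pos_eq; lra)) as HS.
        apply is_series_Re in HS.
        rewrite <- (is_series_unique _ _ (HGs t ltac:(lra))).
        symmetry; apply is_series_unique.
        eapply is_series_ext; [|exact HS].
        intro n; cbv beta; rewrite Cpow_n_eq, Cscal_eq, <- RtoC_pow, <- RtoC_mult.
        apply Rmult_comm. }
    destruct (analytic_at_Re f Z (Hf Z ltac:(lra))) as [a [r1 [Hr1 Ha]]].
    fold F in Ha.
    (* Both expansions are recentred at t0 < Z; the one coming from Z converges
       beyond Z, and nonnegativity transfers this to q. *)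
    set (r := Rmin r1 Z).
    assert (Hr : 0 < r /\ r <= r1 /\ r <= Z).
    { unfold r; pose proof (Rmin_l r1 Z); pose proof (Rmin_r r1 Z).
      split; [now apply Rmin_glb_lt | lra]. }
    (* The offset r/4 keeps t0 inside the disc of q, while r/4 + r/2 < r1 lets the expansion at Z be
       recentred with radius r/2, which reaches t0 + r/2 = Z + r/4. *)
    set (t0 := Z - r / 4).
    assert (Hexa : forall rho, 0 <= rho < r1 -> ex_series (fun n => Rabs (a n) * rho ^ n)).
    { intros rho Hrho; apply ex_series_abs_inside with r1; [|assumption].
      intros x Hx; eexists; apply Ha; rewrite Rabs_pos_eq; lra. }
    assert (HA : forall h, Rabs h <= r / 2 ->
      is_series (fun k => recentred a (- (r / 4)) k * h ^ k) (F (t0 + h))).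
    { intros h Hh; apply recentred_is_series with (r / 2); [lra | assumption | |].
      - apply Hexa; rewrite Rabs_Ropp, Rabs_pos_eq; lra.
      - replace (t0 + h) with (Z + (- (r / 4) + h)) by (unfold t0; ring).
        apply Ha; apply Rabs_le_between in Hh; apply Rabs_def1; lra. }
    assert (HB : forall h, 0 < h < r / 4 ->
      is_series (fun k => recentred q t0 k * h ^ k) (F (t0 + h))).
    { intros h Hh; rewrite HFG by (unfold t0; lra).
      apply recentred_is_series with h; [lra | rewrite Rabs_pos_eq; lra | |].
      - apply ex_series_abs_inside with Z; [assumption|].
        rewrite Rabs_pos_eq; unfold t0; lra.
      - apply HGs; unfold t0; lra. }
    assert (Eab : forall k, recentred a (- (r / 4)) k = recentred q t0 k).
    { apply power_series_unique_right with (fun h => F (t0 + h)) (r / 4); [lra| |exact HB].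
      intros h Hh; apply HA; rewrite Rabs_pos_eq; lra. }
    apply (Hout (t0 + r / 2)); [unfold t0; lra|].
    apply recentred_positive_bound with (F (t0 + r / 2)); auto.
    + unfold t0; lra.
    + lra.
    + intro k; apply taylor_coef_series with (r / 8); [lra|].
      apply ex_series_abs_inside with Z; [assumption|].
      rewrite Rabs_pos_eq; unfold t0; lra.
    + eapply is_series_ext; [|apply HA; rewrite Rabs_pos_eq; lra].
      intro k; cbv beta; now rewrite Eab.
Qed.

(** * Excursions in the quadrant *)

Definition lsum {A : Type} (f : A -> R) (l : list A) : R :=
  fold_right (fun x acc => f x + acc) 0 l.

Lemma lsum_ext {A : Type} (f g : A -> R) (l : list A) :
  (forall x, In x l -> f x = g x) -> lsum f l = lsum g l.
Proof.
  induction l as [|x l IH]; intro H; [reflexivity|]; simpl.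
  rewrite H by (now left); rewrite IH; auto with datatypes.
Qed.

Lemma lsum_le {A : Type} (f g : A -> R) (l : list A) :
  (forall x, In x l -> f x <= g x) -> lsum f l <= lsum g l.
Proof.
  induction l as [|x l IH]; intro H; simpl; [lra|].
  apply Rplus_le_compat; [apply H; now left | apply IH; auto with datatypes].
Qed.

Lemma lsum_plus {A : Type} (f g : A -> R) (l : list A) :
  lsum (fun x => f x + g x) l = lsum f l + lsum g l.
Proof. induction l as [|x l IH]; simpl; lra. Qed.

Lemma lsum_scal {A : Type} (c : R) (f : A -> R) (l : list A) :
  lsum (fun x => c * f x) l = c * lsum f l.
Proof. induction l as [|x l IH]; simpl; [lra | rewrite IH; lra]. Qed.

Lemma lsum_nonneg {A : Type} (f : A -> R) (l : list A) :
  (forall x, In x l -> 0 <= f x) -> 0 <= lsum f l.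
Proof.
  induction l as [|x l IH]; intro H; simpl; [lra|].
  apply Rplus_le_le_0_compat; [apply H; now left | apply IH; auto with datatypes].
Qed.

Lemma lsum_ge_term {A : Type} (f : A -> R) (l : list A) (x : A) :
  (forall y, In y l -> 0 <= f y) -> In x l -> f x <= lsum f l.
Proof.
  induction l as [|y l IH]; intros H Hx; [easy|]; simpl.
  assert (0 <= f y) by (apply H; now left).
  assert (0 <= lsum f l) by (apply lsum_nonneg; auto with datatypes).
  destruct Hx as [<-|Hx]; [lra|].
  assert (f x <= lsum f l) by (apply IH; auto with datatypes); lra.
Qed.

(** Jensen's inequality through the tangent line exp t >= exp T (1 + t - T), which needs no
    normalised weights. *)
Lemma lsum_jensen_exp {A : Type} (w t : A -> R) (l : list A) (T : R) :
  (forall x, In x l -> 0 <= w x) ->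
  lsum w l * T <= lsum (fun x => w x * t x) l ->
  lsum w l * exp T <= lsum (fun x => w x * exp (t x)) l.
Proof.
  intros Hw HT.
  apply Rle_trans with (lsum (fun x => exp T * (w x * t x) + exp T * (1 - T) * w x) l).
  - rewrite lsum_plus, !lsum_scal.
    pose proof (Rmult_le_compat_l (exp T) _ _ ltac:(left; apply exp_pos) HT); nra.
  - apply lsum_le; intros x Hx.
    replace (exp (t x)) with (exp T * exp (t x - T)) by (rewrite <- exp_plus; f_equal; ring).
    pose proof (exp_ineq1_le (t x - T)) as H1.
    pose proof (exp_pos T) as H2; specialize (Hw x Hx).
    pose proof (Rmult_le_compat_l (w x * exp T) _ _ ltac:(apply Rmult_le_pos; lra) H1).
    nra.
Qed.

Definition nb_returns (L : list (Z * Z)) (n : nat) (i j : Z) : nat :=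
  length (filter (returns_to_origin i j) (words L n)).

Lemma nb_returns_outside (L : list (Z * Z)) (n : nat) (i j : Z) :
  ~ (0 <= i /\ 0 <= j)%Z -> nb_returns L n i j = O.
Proof.
  intro H; unfold nb_returns.
  rewrite (filter_ext _ (fun _ => false)).
  - induction (words L n); auto.
  - intros [|[k l] w]; simpl;
      destruct (Z.leb_spec 0 i), (Z.leb_spec 0 j); simpl; try reflexivity; lia.
Qed.

Lemma nb_returns_S (L : list (Z * Z)) (n : nat) (i j : Z) :
  (0 <= i)%Z -> (0 <= j)%Z ->
  INR (nb_returns L (S n) i j)
  = lsum (fun s => INR (nb_returns L n (i + fst s) (j + snd s))) L.
Proof.
  intros Hi Hj; unfold nb_returns; simpl.
  generalize (words L n) as W; intro W.
  induction L as [|[k l] L IH]; [reflexivity|]; simpl.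
  rewrite filter_app, length_app, plus_INR, IH; f_equal; f_equal; clear IH.
  induction W as [|w W IHW]; [reflexivity|]; simpl.
  destruct (Z.leb_spec 0 i), (Z.leb_spec 0 j); try lia; simpl.
  destruct (returns_to_origin (i + k) (j + l) w); simpl; auto.
Qed.

Lemma nb_returns_0 (L : list (Z * Z)) : nb_returns L 0 0 0 = 1%nat.
Proof. reflexivity. Qed.

Definition weight (a b : R) (s : Z * Z) : R := exp (IZR (fst s) * a + IZR (snd s) * b).

(** For every (a, b) the right-hand side satisfies the recursion of the counts with equality when
    the walls are ignored; killing outside the quadrant only lowers the counts. *)
Lemma nb_returns_le (L : list (Z * Z)) (a b : R) (n : nat) (i j : Z) :
  INR (nb_returns L n i j) <= lsum (weight a b) L ^ n * weight a b (i, j).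
Proof.
  assert (Hm : 0 <= lsum (weight a b) L).
  { apply lsum_nonneg; intros x _; left; apply exp_pos. }
  revert i j; induction n as [|n IH]; intros i j.
  - unfold nb_returns, weight; simpl.
    destruct ((0 <=? i) && (0 <=? j) && ((i =? 0) && (j =? 0)))%Z eqn:E; simpl.
    + apply andb_prop in E as [_ E]; apply andb_prop in E as [E1 E2].
      apply Z.eqb_eq in E1, E2; subst.
      rewrite !Rmult_0_l, Rplus_0_l, exp_0; lra.
    + rewrite Rmult_1_l; left; apply exp_pos.
  - destruct (classic (0 <= i /\ 0 <= j)%Z) as [[Hi Hj]|Hout].
    + rewrite nb_returns_S by assumption.
      eapply Rle_trans; [apply lsum_le; intros s _; apply IH|].
      rewrite (lsum_ext _ (fun s => (lsum (weight a b) L ^ n * weight a b (i, j)) * weight a b s)).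
      * rewrite lsum_scal; simpl; lra.
      * intros s _; rewrite Rmult_assoc; f_equal; unfold weight; simpl.
        rewrite <- exp_plus, !plus_IZR; f_equal; ring.
    + rewrite nb_returns_outside by assumption; simpl INR.
      apply Rmult_le_pos; [now apply pow_le | left; apply exp_pos].
Qed.

(** * Paths in the quadrant *)

Inductive qpath (L : list (Z * Z)) : Z -> Z -> nat -> Z -> Z -> Prop :=
| qpath_nil i j : (0 <= i)%Z -> (0 <= j)%Z -> qpath L i j 0 i j
| qpath_cons i j s n i' j' : (0 <= i)%Z -> (0 <= j)%Z -> In s L ->
    qpath L (i + fst s) (j + snd s) n i' j' -> qpath L i j (S n) i' j'.

Lemma qpath_trans (L : list (Z * Z)) i j n i' j' n' i'' j'' :
  qpath L i j n i' j' -> qpath L i' j' n' i'' j'' -> qpath L i j (n + n') i'' j''.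
Proof.
  induction 1; [easy|]; intro H'; simpl.
  apply qpath_cons with s; auto.
Qed.

Lemma qpath_end (L : list (Z * Z)) i j n i' j' :
  qpath L i j n i' j' -> (0 <= i')%Z /\ (0 <= j')%Z.
Proof. induction 1; auto. Qed.

Definition zneg (s : Z * Z) : Z * Z := (- fst s, - snd s)%Z.

Lemma qpath_rev (L : list (Z * Z)) i j n i' j' :
  qpath (map zneg L) i j n i' j' -> qpath L i' j' n i j.
Proof.
  induction 1 as [|i j s n i' j' Hi Hj Hs Hp IH]; [now constructor|].
  apply in_map_iff in Hs as [s' [<- Hs]].
  replace (S n) with (n + 1)%nat by lia.
  eapply qpath_trans; [exact IH|].
  pose proof (qpath_end _ _ _ _ _ _ IH) as [H1 H2]; simpl in *.
  apply qpath_cons with s'; auto; simpl.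
  replace (i + - fst s' + fst s')%Z with i by ring.
  replace (j + - snd s' + snd s')%Z with j by ring.
  now constructor.
Qed.

(** The quadrant is convex, so only the two ends of a straight run need checking. *)
Lemma qpath_straight (L : list (Z * Z)) (s : Z * Z) (n : nat) (i j : Z) :
  In s L -> (0 <= i)%Z -> (0 <= j)%Z ->
  (0 <= i + Z.of_nat n * fst s)%Z -> (0 <= j + Z.of_nat n * snd s)%Z ->
  qpath L i j n (i + Z.of_nat n * fst s) (j + Z.of_nat n * snd s).
Proof.
  intro Hs; revert i j; induction n as [|n IH]; intros i j Hi Hj Hi' Hj'.
  - simpl; rewrite !Z.add_0_r; now constructor.
  - apply qpath_cons with s; auto.
    replace (i + Z.of_nat (S n) * fst s)%Z
      with (i + fst s + Z.of_nat n * fst s)%Z in * by lia.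
    replace (j + Z.of_nat (S n) * snd s)%Z
      with (j + snd s + Z.of_nat n * snd s)%Z in * by lia.
    apply IH; auto; nia.
Qed.

(** With (1, 0), go 2D steps east and then D steps having a northward component, which lose at most
    D to the west. The case (0, 1) is symmetric, and (1, 1) suffices alone. *)
Lemma qpath_deep (L : list (Z * Z)) (D : nat) :
  (forall s, In s L -> -1 <= fst s <= 1 /\ -1 <= snd s <= 1)%Z ->
  (exists j, In (1, j)%Z L) -> (exists i, In (i, 1)%Z L) ->
  In (1, 0)%Z L \/ In (0, 1)%Z L \/ In (1, 1)%Z L ->
  exists x y k, (Z.of_nat D <= x)%Z /\ (Z.of_nat D <= y)%Z /\ qpath L 0 0 k x y.
Proof.
  intros Hsmall [j Hj] [i Hi] H.
  destruct H as [H|[H|H]].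
  - pose proof (Hsmall _ Hi) as HB; simpl in HB.
    pose proof (qpath_straight L _ (2 * D) 0 0 H ltac:(lia) ltac:(lia)
                  ltac:(simpl fst; lia) ltac:(simpl snd; lia)) as P1.
    simpl fst in P1; simpl snd in P1; simpl Z.add in P1.
    eexists _, _, _; split; [|split];
      [| |eapply qpath_trans; [exact P1 | apply (qpath_straight L _ D _ _ Hi)]];
      simpl fst; simpl snd; nia.
  - pose proof (Hsmall _ Hj) as HB; simpl in HB.
    pose proof (qpath_straight L _ (2 * D) 0 0 H ltac:(lia) ltac:(lia)
                  ltac:(simpl fst; lia) ltac:(simpl snd; lia)) as P1.
    simpl fst in P1; simpl snd in P1; simpl Z.add in P1.
    eexists _, _, _; split; [|split];
      [| |eapply qpath_trans; [exact P1 | apply (qpath_straight L _ D _ _ Hj)]];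
      simpl fst; simpl snd; nia.
  - eexists _, _, _; split; [|split];
      [| |apply (qpath_straight L _ D 0 0 H)]; simpl fst; simpl snd; lia.
Qed.

(** * Green function of the killed walk *)

Definition green_term (L : list (Z * Z)) (z : R) (i j : Z) (n : nat) : R :=
  INR (nb_returns L n i j) * z ^ n.

(** A function of the starting point, the target being the origin. [Series] is total, so finiteness
    has to be carried along separately. *)
Definition green (L : list (Z * Z)) (z : R) (i j : Z) : R :=
  Series (green_term L z i j).

Lemma green_term_pos (L : list (Z * Z)) (z : R) (i j : Z) (n : nat) :
  0 < z -> 0 <= green_term L z i j n.
Proof. intro Hz; apply Rmult_le_pos; [apply pos_INR | apply pow_le; lra]. Qed.

Lemma series_nonneg (f : nat -> R) :
  (forall n, 0 <= f n) -> ex_series f -> 0 <= Series f.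
Proof.
  intros Hf H; rewrite <- (Rmult_0_l (Series f)), <- Series_scal_l.
  apply Series_le; [|exact H]; intro n; specialize (Hf n); lra.
Qed.

Lemma ex_series_lsum {A : Type} (f : A -> nat -> R) (l : list A) :
  (forall x, In x l -> ex_series (f x)) ->
  is_series (fun n => lsum (fun x => f x n) l) (lsum (fun x => Series (f x)) l).
Proof.
  induction l as [|x l IH]; intro H; simpl.
  - apply is_series_Reals; intros eps Heps; exists O; intros n _.
    rewrite sum_cte; unfold Rdist; rewrite Rmult_0_l, Rminus_diag, Rabs_R0; exact Heps.
  - apply (is_series_plus (f x) (fun n => lsum (fun x => f x n) l)).
    + apply Series_correct, H; now left.
    + apply IH; auto with datatypes.
Qed.

(** Prefixing s turns each return from the neighbour into a return from (i, j) that is one step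
    longer, at the price of a factor 1/z. *)
Lemma green_finite_step (L : list (Z * Z)) (z : R) (i j : Z) (s : Z * Z) :
  0 < z -> (0 <= i)%Z -> (0 <= j)%Z -> In s L ->
  ex_series (green_term L z i j) ->
  ex_series (green_term L z (i + fst s) (j + snd s)).
Proof.
  intros Hz Hi Hj Hs Hex.
  apply (@ex_series_le R_AbsRing R_CompleteNormedModule _
          (fun n => / z * green_term L z i j (S n))).
  - intro n; change (Rabs (green_term L z (i + fst s) (j + snd s) n)
                     <= / z * green_term L z i j (S n)).
    rewrite Rabs_pos_eq by now apply green_term_pos.
    unfold green_term; rewrite nb_returns_S by assumption.
    replace (/ z * (lsum (fun s => INR (nb_returns L n (i + fst s) (j + snd s))) L * z ^ S n))
      with (lsum (fun s => INR (nb_returns L n (i + fst s) (j + snd s))) L * z ^ n)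
      by (simpl; field; lra).
    apply Rmult_le_compat_r; [apply pow_le; lra|].
    apply (lsum_ge_term (fun s => INR (nb_returns L n (i + fst s) (j + snd s)))); auto.
    intros; apply pos_INR.
  - apply (ex_series_scal_l (V := R_NormedModule)).
    now apply (ex_series_incr_1 (green_term L z i j)).
Qed.

(** First-step decomposition; the inequality only drops the nonnegative term n = 0. *)
Lemma green_super (L : list (Z * Z)) (z : R) (i j : Z) :
  0 < z -> (0 <= i)%Z -> (0 <= j)%Z -> ex_series (green_term L z i j) ->
  z * lsum (fun s => green L z (i + fst s) (j + snd s)) L <= green L z i j.
Proof.
  intros Hz Hi Hj Hex.
  unfold green at 2; rewrite Series_incr_1 by assumption.
  assert (E : Series (fun n => green_term L z i j (S n))
              = z * lsum (fun s => green L z (i + fst s) (j + snd s)) L).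
  { apply is_series_unique.
    assert (HS := ex_series_lsum (fun s => green_term L z (i + fst s) (j + snd s)) L
      (fun s Hs => green_finite_step L z i j s Hz Hi Hj Hs Hex)).
    eapply is_series_ext; [|exact (is_series_scal_l (V := R_NormedModule) z _ _ HS)].
    intro n; unfold green_term, scal; simpl; unfold mult; simpl.
    rewrite nb_returns_S by assumption.
    rewrite (lsum_ext _ (fun s => z ^ n * INR (nb_returns L n (i + fst s) (j + snd s))))
      by (intros; apply Rmult_comm).
    rewrite lsum_scal; ring. }
  rewrite E; pose proof (green_term_pos L z i j 0 Hz); lra.
Qed.

(** A one-sided Harnack inequality. Finiteness travels forwards along the path, the lower bound
    backwards. *)
Lemma green_qpath (L : list (Z * Z)) (z : R) i j n i' j' :
  0 < z -> qpath L i j n i' j' -> ex_series (green_term L z i j) ->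
  ex_series (green_term L z i' j') /\ z ^ n * green L z i' j' <= green L z i j.
Proof.
  intros Hz H; induction H as [i j|i j s n i' j' Hi Hj Hs H IH]; intro Hex.
  - split; [assumption | simpl; lra].
  - assert (Hex' := green_finite_step L z i j s Hz Hi Hj Hs Hex).
    destruct (IH Hex') as [H1 H2]; split; [assumption|].
    eapply Rle_trans; [|apply green_super; assumption].
    simpl; rewrite Rmult_assoc; apply Rmult_le_compat_l; [lra|].
    eapply Rle_trans; [exact H2|].
    apply (lsum_ge_term (fun s => green L z (i + fst s) (j + snd s))); [|assumption].
    intros y Hy; apply series_nonneg; [intro; now apply green_term_pos|].
    now apply green_finite_step.
Qed.

(** * Arithmetic of the step sets *)

Fixpoint sublists {A : Type} (l : list A) : list (list A) :=
  match l with
  | [] => [[]]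
  | x :: l' => sublists l' ++ map (cons x) (sublists l')
  end.

Lemma filter_sublists {A : Type} (f : A -> bool) (l : list A) :
  In (filter f l) (sublists l).
Proof.
  induction l as [|x l IH]; simpl; [now left|].
  apply in_or_app; destruct (f x); [right; now apply in_map | now left].
Qed.

Definition zadd (s v : Z * Z) : Z * Z := (fst s + fst v, snd s + snd v)%Z.
Definition zeqb (s v : Z * Z) : bool := ((fst s =? fst v) && (snd s =? snd v))%Z.
Definition zmem (v : Z * Z) (l : list (Z * Z)) : bool := existsb (zeqb v) l.
Definition zsum (w : list (Z * Z)) : Z * Z := fold_right zadd (0, 0)%Z w.

Lemma zeqb_eq (s v : Z * Z) : zeqb s v = true -> s = v.
Proof.
  destruct s, v; unfold zeqb; simpl; intro H.
  apply andb_prop in H as [H1 H2]; apply Z.eqb_eq in H1, H2; congruence.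
Qed.

Lemma zmem_In (v : Z * Z) (l : list (Z * Z)) : zmem v l = true -> In v l.
Proof.
  intro H; apply existsb_exists in H as [x [Hx E]].
  now apply zeqb_eq in E; subst.
Qed.

Lemma In_zmem (v : Z * Z) (l : list (Z * Z)) : In v l -> zmem v l = true.
Proof.
  intro H; apply existsb_exists; exists v; split; [assumption|].
  unfold zeqb; now rewrite !Z.eqb_refl.
Qed.

(* Truncating the search to a small window keeps the enumeration over all
   256 step sets cheap. *)
Definition small_window (v : Z * Z) : bool :=
  ((Z.abs (fst v) <=? 2) && (Z.abs (snd v) <=? 2))%Z.

Definition extend_sums (L pts : list (Z * Z)) : list (Z * Z) :=
  fold_right (fun v acc => if small_window v && negb (zmem v acc) then v :: acc else acc)
    pts (flat_map (fun p => map (fun s => zadd s p) L) pts).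

(** Sums of at most four steps, with partial sums kept in the window; four is long enough for
    [model_facts_enumeration] to succeed. *)
Definition short_sums (L : list (Z * Z)) : list (Z * Z) :=
  Nat.iter 4 (extend_sums L) [(0, 0)%Z].

Definition is_word_sum (L : list (Z * Z)) (v : Z * Z) : Prop :=
  exists w, (forall s, In s w -> In s L) /\ zsum w = v.

Lemma short_sums_sound (L : list (Z * Z)) (v : Z * Z) :
  In v (short_sums L) -> is_word_sum L v.
Proof.
  assert (H : forall n v, In v (Nat.iter n (extend_sums L) [(0, 0)%Z]) -> is_word_sum L v).
  { induction n as [|n IH]; intros u Hu.
    - destruct Hu as [<-|[]]; exists []; split; [easy|reflexivity].
    - simpl in Hu; unfold extend_sums at 1 in Hu.
      set (pts := Nat.iter n (extend_sums L) [(0, 0)%Z]) in *.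
      assert (Hor : In u pts \/ In u (flat_map (fun p => map (fun s => zadd s p) L) pts)).
      { revert Hu; generalize (flat_map (fun p => map (fun s => zadd s p) L) pts).
        induction l as [|x l IHl]; simpl; [auto|].
        destruct (small_window x && _); simpl; intuition. }
      destruct Hor as [|Hin]; [auto|].
      apply in_flat_map in Hin as [p [Hp Hin]].
      apply in_map_iff in Hin as [s [<- Hs]].
      destruct (IH p Hp) as [w [Hw <-]].
      exists (s :: w); split; [|reflexivity].
      intros s' [<-|Hs']; auto. }
  apply H.
Qed.

Definition all_in (vs L : list (Z * Z)) : bool := forallb (fun v => zmem v L) vs.

(** Consequences of [is_model] in boolean form, together with the existence of a step with i + j <
    0, without which (-1, -1) is not a sum of steps. *)
Definition model_conditions (L : list (Z * Z)) : bool :=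
  existsb (fun s => fst s =? 1)%Z L && existsb (fun s => fst s =? -1)%Z L &&
  existsb (fun s => snd s =? 1)%Z L && existsb (fun s => snd s =? -1)%Z L &&
  negb (forallb (fun s => snd s <=? fst s)%Z L) &&
  negb (forallb (fun s => fst s <=? snd s)%Z L) &&
  negb (forallb (fun s => 0 <=? fst s + snd s)%Z L) &&
  (zmem (1, 0)%Z L || zmem (0, 1)%Z L || zmem (1, 1)%Z L).

(** The convex hull of the steps meets the vertical axis on the side e, at height at least 1/2. This
    makes the minimum over x of the step polynomial blow up as y tends to infinity (e = 1) or to 0
    (e = -1). *)
Definition straddles (L : list (Z * Z)) (e : Z) : bool :=
  zmem (0, e)%Z L ||
  existsb (fun s => (fst s =? 1)%Z &&
    existsb (fun t => (fst t =? -1) && (1 <=? e * (snd s + snd t)))%Z L) L.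

Definition diagonals : list (Z * Z) := [(1, 1); (-1, -1); (1, -1); (-1, 1)]%Z.
Definition units : list (Z * Z) := [(1, 0); (-1, 0); (0, 1); (0, -1)]%Z.

(** Sums with repetition reach opposite vectors, so the semigroup generated by the steps is a
    lattice: the even sublattice when i + j is even for all steps, Z^2 otherwise. *)
Definition model_facts (L : list (Z * Z)) : bool :=
  all_in diagonals (short_sums L) &&
  (forallb (fun s => Z.even (fst s + snd s)) L || all_in units (short_sums L)) &&
  straddles L 1 && straddles L (-1).

Lemma model_facts_enumeration :
  forallb (fun L => implb (model_conditions L) (model_facts L))
    (sublists nonzero_small_steps) = true.
Proof. vm_compute. reflexivity. Qed.

Lemma step_list_In (St : Z * Z -> bool) (s : Z * Z) :
  is_model St -> St s = true <-> In s (step_list St).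
Proof.
  intro H; unfold step_list; rewrite filter_In; split; [|tauto].
  intro Hs; split; [|assumption]; now apply (small_steps _ H).
Qed.

Lemma step_list_small (St : Z * Z -> bool) (s : Z * Z) :
  In s (step_list St) -> (-1 <= fst s <= 1 /\ -1 <= snd s <= 1)%Z.
Proof.
  intro H; unfold step_list in H; apply filter_In in H as [H _].
  simpl in H; intuition; subst; simpl; lia.
Qed.

Lemma not_all_steps_forallb (St : Z * Z -> bool) (f : Z * Z -> bool) :
  is_model St -> ~ (forall s, St s = true -> f s = true) ->
  negb (forallb f (step_list St)) = true.
Proof.
  intros HM H; destruct (forallb f (step_list St)) eqn:E; [exfalso|reflexivity].
  apply H; intros s Hs; rewrite forallb_forall in E.
  apply E; now apply step_list_In.
Qed.

Lemma model_facts_hold (St : Z * Z -> bool) :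
  is_model St -> (exists i j, St (i, j) = true /\ (i + j < 0)%Z) ->
  model_facts (step_list St) = true.
Proof.
  intros HM [i0 [j0 [Hs0 Hneg]]].
  pose proof model_facts_enumeration as HE; rewrite forallb_forall in HE.
  specialize (HE _ (filter_sublists St nonzero_small_steps)).
  change (filter St nonzero_small_steps) with (step_list St) in HE.
  destruct (model_conditions (step_list St)) eqn:EC; [exact HE|exfalso].
  enough (model_conditions (step_list St) = true) by congruence.
  unfold model_conditions; repeat (apply andb_true_intro; split).
  - destruct (has_east _ HM) as [j Hj]; apply existsb_exists.
    eexists; split; [apply step_list_In; eassumption | reflexivity].
  - destruct (has_west _ HM) as [j Hj]; apply existsb_exists.
    eexists; split; [apply step_list_In; eassumption | reflexivity].
  - destruct (has_north _ HM) as [j Hj]; apply existsb_exists.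
    eexists; split; [apply step_list_In; eassumption | reflexivity].
  - destruct (has_south _ HM) as [j Hj]; apply existsb_exists.
    eexists; split; [apply step_list_In; eassumption | reflexivity].
  - apply not_all_steps_forallb; [assumption|]; intro H.
    apply (not_below_diagonal _ HM); intros i j Hij.
    specialize (H _ Hij); simpl in H; apply Z.leb_le in H; lia.
  - apply not_all_steps_forallb; [assumption|]; intro H.
    apply (not_above_diagonal _ HM); intros i j Hij.
    specialize (H _ Hij); simpl in H; apply Z.leb_le in H; lia.
  - apply not_all_steps_forallb; [assumption|]; intro H.
    specialize (H _ Hs0); simpl in H; apply Z.leb_le in H; lia.
  - destruct (leaves_origin _ HM) as [H|[H|H]];
      apply (step_list_In _ _ HM), In_zmem in H; rewrite H, ?orb_true_r; reflexivity.
Qed.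

(** * Communication between points far from the walls *)

Lemma word_qpath (L : list (Z * Z)) (w : list (Z * Z)) (i j : Z) :
  (forall s, In s L -> -1 <= fst s <= 1 /\ -1 <= snd s <= 1)%Z ->
  (forall s, In s w -> In s L) ->
  (Z.of_nat (length w) <= i)%Z -> (Z.of_nat (length w) <= j)%Z ->
  qpath L i j (length w) (i + fst (zsum w)) (j + snd (zsum w)).
Proof.
  intro HL; revert i j; induction w as [|s w IH]; intros i j Hw Hi Hj; simpl.
  - rewrite !Z.add_0_r; simpl in *; now constructor.
  - simpl length in *; pose proof (HL s (Hw s (or_introl eq_refl))) as Hs.
    apply qpath_cons with s; [lia | lia | apply Hw; now left|].
    rewrite !Z.add_assoc; apply IH; auto with datatypes; lia.
Qed.

(** One constant [l] serves as length bound and as margin: small steps cannot cross a margin of l in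
    l steps. *)
Definition realises (L : list (Z * Z)) (l : nat) (v : Z * Z) : Prop :=
  forall i j, (Z.of_nat l <= i)%Z -> (Z.of_nat l <= j)%Z ->
  exists k, (k <= l)%nat /\ qpath L i j k (i + fst v) (j + snd v).

Lemma realises_all (L vs : list (Z * Z)) :
  (forall s, In s L -> -1 <= fst s <= 1 /\ -1 <= snd s <= 1)%Z ->
  (forall v, In v vs -> is_word_sum L v) ->
  exists l, forall v, In v vs -> realises L l v.
Proof.
  intros HL; induction vs as [|v vs IH]; intro H; [exists O; easy|].
  destruct IH as [l Hl]; [auto with datatypes|].
  destruct (H v (or_introl eq_refl)) as [w [Hw <-]].
  exists (l + length w)%nat; intros u [<-|Hu] i j Hi Hj.
  - exists (length w); split; [lia|]; apply word_qpath; auto; lia.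
  - destruct (Hl u Hu i j ltac:(lia) ltac:(lia)) as [k [Hk P]].
    exists k; split; [lia | assumption].
Qed.

(* The steps span either Z^2, with the standard basis, or the even sublattice,
   with basis (1, 1), (1, -1). *)
Record step_basis (L : list (Z * Z)) (l : nat) (e f : Z * Z) : Prop := {
  basis_moves : forall v, In v [e; zneg e; f; zneg f; (1, 1); (-1, -1)]%Z -> realises L l v;
  basis_small : (Z.abs (fst e) <= 1 /\ Z.abs (snd e) <= 1 /\
                 Z.abs (fst f) <= 1 /\ Z.abs (snd f) <= 1)%Z;
  basis_span : forall s, In s L -> exists x y, s = (x * fst e + y * fst f, x * snd e + y * snd f)%Z;
  basis_norm : forall x y, (Z.abs x + Z.abs y <=
     Z.abs (x * fst e + y * fst f) + Z.abs (x * snd e + y * snd f))%Z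
}.

Lemma step_basis_exists (L : list (Z * Z)) :
  (forall s, In s L -> -1 <= fst s <= 1 /\ -1 <= snd s <= 1)%Z ->
  model_facts L = true -> exists l e f, step_basis L l e f.
Proof.
  intros HL H; unfold model_facts in H.
  apply andb_prop in H as [H _]; apply andb_prop in H as [H _].
  apply andb_prop in H as [Hd Hu].
  unfold all_in in Hd; rewrite forallb_forall in Hd.
  assert (Hdw : forall v, In v diagonals -> is_word_sum L v).
  { intros v Hv; apply short_sums_sound, zmem_In; auto. }
  apply orb_prop in Hu as [He|Hu].
  - rewrite forallb_forall in He.
    destruct (realises_all L diagonals HL Hdw) as [l Hl].
    exists l, (1, 1)%Z, (1, -1)%Z; split; cbn [fst snd].
    + intros v Hv; apply Hl; simpl in *; intuition.
    + lia.
    + intros [i j] Hs; specialize (He _ Hs); apply Z.even_spec in He as [x Hx].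
      cbn [fst snd] in Hx; exists x, (i - x)%Z; f_equal; lia.
    + intros x y; lia.
  - unfold all_in in Hu; rewrite forallb_forall in Hu.
    destruct (realises_all L (diagonals ++ units) HL) as [l Hl].
    { intros v Hv; apply in_app_or in Hv as [Hv|Hv]; auto.
      apply short_sums_sound, zmem_In; auto. }
    exists l, (1, 0)%Z, (0, 1)%Z; split; cbn [fst snd].
    + intros v Hv; apply Hl; simpl in *; intuition.
    + lia.
    + intros [i j] Hs; exists i, j; f_equal; lia.
    + intros x y; lia.
Qed.

(** Each basis move lowers |x| + |y| by one and costs at most l steps. The moves start within N of
    (p, q) in both coordinates, since the entries of e and f are at most 1 in modulus; hence the
    margin l + N. *)
Lemma basis_path (L : list (Z * Z)) (l : nat) (e f : Z * Z) (N : nat) (x y p q : Z) :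
  step_basis L l e f -> (Z.abs x + Z.abs y <= Z.of_nat N)%Z ->
  (Z.of_nat l + Z.of_nat N <= p)%Z -> (Z.of_nat l + Z.of_nat N <= q)%Z ->
  exists k, (k <= l * N)%nat /\
    qpath L (p + x * fst e + y * fst f) (q + x * snd e + y * snd f) k p q.
Proof.
  intros HB; revert x y; induction N as [|N IH]; intros x y HN Hp Hq.
  - assert (x = 0 /\ y = 0)%Z as [-> ->] by lia.
    exists O; split; [lia|]; simpl; rewrite !Z.add_0_r; constructor; lia.
  - destruct (basis_small _ _ _ _ HB) as [E1 [E2 [E3 E4]]].
    assert (Hstep : forall x' y' v, In v [e; zneg e; f; zneg f; (1, 1); (-1, -1)]%Z ->
      (p + x * fst e + y * fst f + fst v = p + x' * fst e + y' * fst f)%Z ->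
      (q + x * snd e + y * snd f + snd v = q + x' * snd e + y' * snd f)%Z ->
      (Z.abs x' + Z.abs y' <= Z.of_nat N)%Z ->
      exists k, (k <= l * S N)%nat /\
        qpath L (p + x * fst e + y * fst f) (q + x * snd e + y * snd f) k p q).
    { intros x' y' v Hv Ev1 Ev2 HN'.
      destruct (IH x' y' HN' ltac:(lia) ltac:(lia)) as [k [Hk P]].
      destruct (basis_moves _ _ _ _ HB v Hv (p + x * fst e + y * fst f)
                  (q + x * snd e + y * snd f))%Z as [k' [Hk' P']]; [nia | nia |].
      rewrite Ev1, Ev2 in P'.
      exists (k' + k)%nat; split; [lia|].
      eapply qpath_trans; eassumption. }
    destruct (Z.lt_trichotomy x 0) as [Hx|[Hx|Hx]].
    + apply (Hstep (x + 1)%Z y e); [simpl; auto | ring | ring | lia].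
    + destruct (Z.lt_trichotomy y 0) as [Hy|[Hy|Hy]].
      * apply (Hstep x (y + 1)%Z f); [simpl; auto | ring | ring | lia].
      * subst; destruct (IH 0%Z 0%Z ltac:(lia) ltac:(lia) ltac:(lia)) as [k [Hk P]].
        exists k; split; [lia | exact P].
      * apply (Hstep x (y - 1)%Z (zneg f)); [simpl; auto 6 | simpl; ring | simpl; ring | lia].
    + apply (Hstep (x - 1)%Z y (zneg e)); [simpl; auto | simpl; ring | simpl; ring | lia].
Qed.

Lemma diagonal_path (L : list (Z * Z)) (l : nat) (e f : Z * Z) (n : nat) (p q : Z) :
  step_basis L l e f -> (Z.of_nat l <= p)%Z -> (Z.of_nat l <= q)%Z ->
  (exists k, qpath L p q k (p + Z.of_nat n) (q + Z.of_nat n)) /\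
  (exists k, qpath L (p + Z.of_nat n) (q + Z.of_nat n) k p q).
Proof.
  intros HB Hp Hq; induction n as [|n [[k1 IH1] [k2 IH2]]].
  - split; exists O; simpl; rewrite !Z.add_0_r; constructor; lia.
  - destruct (basis_moves _ _ _ _ HB (1, 1)%Z ltac:(simpl; auto 6)
      (p + Z.of_nat n)%Z (q + Z.of_nat n)%Z ltac:(lia) ltac:(lia)) as [k [_ P]].
    destruct (basis_moves _ _ _ _ HB (-1, -1)%Z ltac:(simpl; auto 7)
      (p + Z.of_nat (S n))%Z (q + Z.of_nat (S n))%Z ltac:(lia) ltac:(lia)) as [k' [_ P']].
    simpl fst in *; simpl snd in *.
    replace (p + Z.of_nat n + 1)%Z with (p + Z.of_nat (S n))%Z in P by lia.
    replace (q + Z.of_nat n + 1)%Z with (q + Z.of_nat (S n))%Z in P by lia.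
    replace (p + Z.of_nat (S n) + -1)%Z with (p + Z.of_nat n)%Z in P' by lia.
    replace (q + Z.of_nat (S n) + -1)%Z with (q + Z.of_nat n)%Z in P' by lia.
    split; eexists; eapply qpath_trans; eassumption.
Qed.

Definition in_lattice (e f : Z * Z) (i j : Z) : Prop :=
  exists x y, (i = x * fst e + y * fst f /\ j = x * snd e + y * snd f)%Z.

Lemma qpath_in_lattice (L : list (Z * Z)) (l : nat) (e f : Z * Z) i j n i' j' :
  step_basis L l e f -> qpath L i j n i' j' -> in_lattice e f (i' - i) (j' - j).
Proof.
  intros HB; induction 1 as [i j|i j s n i' j' _ _ Hs _ [x [y [E1 E2]]]].
  - exists 0%Z, 0%Z; lia.
  - destruct (basis_span _ _ _ _ HB s Hs) as [x' [y' ->]]; simpl in *.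
    exists (x + x')%Z, (y + y')%Z; split; lia.
Qed.

Lemma in_lattice_step (L : list (Z * Z)) (l : nat) (e f : Z * Z) (s : Z * Z) (i j : Z) :
  step_basis L l e f -> In s L -> in_lattice e f i j ->
  in_lattice e f (i + fst s) (j + snd s).
Proof.
  intros HB Hs [x [y [-> ->]]].
  destruct (basis_span _ _ _ _ HB s Hs) as [x' [y' ->]]; simpl.
  exists (x + x')%Z, (y + y')%Z; lia.
Qed.

(** One path leads out of the origin, another, found for the negated steps and then reversed, leads
    back. Their deep ends differ by a lattice vector, and pushing both ends along the diagonal
    leaves room to join them. *)
Lemma deep_recurrent_points (L : list (Z * Z)) (l : nat) (e f : Z * Z) (n : nat) :
  step_basis L l e f ->
  (forall s, In s L -> -1 <= fst s <= 1 /\ -1 <= snd s <= 1)%Z ->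
  (exists j, In (1, j)%Z L) -> (exists j, In (-1, j)%Z L) ->
  (exists i, In (i, 1)%Z L) -> (exists i, In (i, -1)%Z L) ->
  In (1, 0)%Z L \/ In (0, 1)%Z L \/ In (1, 1)%Z L ->
  In (-1, 0)%Z L \/ In (0, -1)%Z L \/ In (-1, -1)%Z L ->
  exists p q k k', (Z.of_nat n <= p)%Z /\ (Z.of_nat n <= q)%Z /\
    qpath L 0 0 k p q /\ qpath L p q k' 0 0.
Proof.
  intros HB HL He Hw Hn Hs Hout Hin.
  destruct (qpath_deep L l HL He Hn Hout) as [a [b [k1 [Ha [Hb P1]]]]].
  assert (Hneg : forall i j, In (i, j) L -> In (- i, - j)%Z (map zneg L)).
  { intros i j H; apply in_map_iff; exists (i, j); auto. }
  destruct (qpath_deep (map zneg L) l) as [c [d [k2 [Hc [Hd P2]]]]].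
  { intros s Hs'; apply in_map_iff in Hs' as [s' [<- Hs']].
    specialize (HL s' Hs'); simpl; lia. }
  { destruct Hw as [j Hj]; exists (- j)%Z; now apply (Hneg (-1)%Z j). }
  { destruct Hs as [j Hj]; exists (- j)%Z; now apply (Hneg j (-1)%Z). }
  { destruct Hin as [H|[H|H]]; apply Hneg in H; auto. }
  apply qpath_rev in P2.
  pose proof (qpath_in_lattice _ _ _ _ _ _ _ _ _ HB P1) as [x1 [y1 [E1 E2]]].
  pose proof (qpath_in_lattice _ _ _ _ _ _ _ _ _ HB P2) as [x2 [y2 [E3 E4]]].
  (* Coordinates of (a, b) - (c, d) in the basis e, f. *)
  set (x := (x1 + x2)%Z); set (y := (y1 + y2)%Z).
  set (M := Z.to_nat (Z.abs x + Z.abs y)).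
  set (N := (n + M)%nat).
  destruct (diagonal_path L l e f N a b HB ltac:(lia) ltac:(lia)) as [[k3 P3] _].
  destruct (diagonal_path L l e f N c d HB ltac:(lia) ltac:(lia)) as [_ [k4 P4]].
  destruct (basis_path L l e f M x y (c + Z.of_nat N) (d + Z.of_nat N) HB)
    as [k5 [_ P5]]; [lia | lia | lia |].
  replace (c + Z.of_nat N + x * fst e + y * fst f)%Z with (a + Z.of_nat N)%Z in P5
    by (unfold x, y; lia).
  replace (d + Z.of_nat N + x * snd e + y * snd f)%Z with (b + Z.of_nat N)%Z in P5
    by (unfold x, y; lia).
  exists (a + Z.of_nat N)%Z, (b + Z.of_nat N)%Z.
  eexists _, _; split; [lia|]; split; [lia|]; split.
  - eapply qpath_trans; eassumption.
  - eapply qpath_trans; [exact P5|]; eapply qpath_trans; eassumption.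
Qed.

(** * Exponential growth of excursions *)

Lemma exp_le (x y : R) : x <= y -> exp x <= exp y.
Proof. intros [H|H]; [left; now apply exp_increasing | right; now rewrite H]. Qed.

(* Lower barrier for the Green function, relative to its value at a base point;
   the quadratic absorbs the displacement because the tilted walk is centred. *)
Definition barrier (a b K eps c : R) (k : nat) (x y : R) : R :=
  x * a + y * b - K * (/ (2 * eps) + eps * (x ^ 2 + y ^ 2 + 2 * INR k)) + c * INR k.

(** The quadratic is a smooth majorant of |x| + |y|, by |t| <= 1/(4 eps) + eps t^2; the extra |a| +
    |b| pays for the tilt x a + y b. *)
Lemma barrier_base (a b K eps c x y : R) :
  0 < eps -> 0 <= K ->
  barrier a b (K + Rabs a + Rabs b) eps c 0 x y <= - K * (Rabs x + Rabs y).
Proof.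
  intros Heps HK; unfold barrier; simpl INR.
  assert (H : Rabs x + Rabs y <= / (2 * eps) + eps * (x ^ 2 + y ^ 2 + 2 * 0)).
  { assert (H1 : forall t, Rabs t <= / (4 * eps) + eps * t ^ 2).
    { intro t.
      assert (E : / (4 * eps) + eps * t ^ 2 - Rabs t = (2 * eps * Rabs t - 1) ^ 2 / (4 * eps)).
      { rewrite <- (pow2_abs t); field; lra. }
      assert (0 <= (2 * eps * Rabs t - 1) ^ 2 / (4 * eps)); [|lra].
      apply Rmult_le_pos; [apply pow2_ge_0 | left; apply Rinv_0_lt_compat; lra]. }
    assert (E : / (2 * eps) = / (4 * eps) + / (4 * eps)) by (field; lra).
    pose proof (H1 x); pose proof (H1 y); lra. }
  assert (Hx : x * a <= Rabs a * Rabs x).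
  { rewrite <- Rabs_mult, Rmult_comm; apply Rle_abs. }
  assert (Hy : y * b <= Rabs b * Rabs y).
  { rewrite <- Rabs_mult, Rmult_comm; apply Rle_abs. }
  pose proof (Rabs_pos a); pose proof (Rabs_pos b);
  pose proof (Rabs_pos x); pose proof (Rabs_pos y).
  assert (HK' : 0 <= K + Rabs a + Rabs b) by lra.
  pose proof (Rmult_le_compat_l _ _ _ HK' H); nra.
Qed.

(** Under the tilted weights the steps have mean zero, so the cross terms of |(x, y) + s|^2 average
    out, and |s|^2 <= 2 is paid for by the increment of 2 k. Jensen turns this bound on the averaged
    exponent into one on the exponentials. *)
Lemma barrier_step (L : list (Z * Z)) (a b K eps c x y : R) (k : nat) :
  (forall s, In s L -> -1 <= fst s <= 1 /\ -1 <= snd s <= 1)%Z ->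
  lsum (fun s => weight a b s * IZR (fst s)) L = 0 ->
  lsum (fun s => weight a b s * IZR (snd s)) L = 0 ->
  0 < eps -> 0 <= K ->
  lsum (weight a b) L * exp (barrier a b K eps c (S k) x y - c)
  <= lsum (fun s => exp (barrier a b K eps c k (x + IZR (fst s)) (y + IZR (snd s)))) L.
Proof.
  intros HL Hx Hy Heps HK.
  apply Rle_trans with (lsum (fun s => weight a b s *
    exp (barrier a b K eps c k (x + IZR (fst s)) (y + IZR (snd s))
         - (IZR (fst s) * a + IZR (snd s) * b))) L).
  - apply lsum_jensen_exp; [intros; left; apply exp_pos|].
    set (B := x * a + y * b - K * (/ (2 * eps) + eps * (x ^ 2 + y ^ 2 + 2 * INR k + 2)) + c * INR k).
    replace (barrier a b K eps c (S k) x y - c) with B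
      by (unfold barrier, B; rewrite S_INR; ring).
    apply Rle_trans with (lsum (fun s =>
        B * weight a b s + (- 2 * K * eps * x) * (weight a b s * IZR (fst s))
        + (- 2 * K * eps * y) * (weight a b s * IZR (snd s))) L).
    + rewrite !lsum_plus, !lsum_scal, Hx, Hy; lra.
    + apply lsum_le; intros s Hs.
      assert (Hw : 0 < weight a b s) by apply exp_pos.
      destruct (HL s Hs) as [H1 H2].
      assert (Hsq : IZR (fst s) ^ 2 + IZR (snd s) ^ 2 <= 2).
      { destruct H1 as [H1 H1'], H2 as [H2 H2'].
        apply IZR_le in H1, H1', H2, H2'; nra. }
      assert (HKe : 0 <= K * eps) by (apply Rmult_le_pos; lra).
      apply Rle_trans with (weight a b s *
        (B - 2 * K * eps * x * IZR (fst s) - 2 * K * eps * y * IZR (snd s))); [lra|].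
      apply Rmult_le_compat_l; [lra|].
      unfold barrier, B; nra.
  - right; apply lsum_ext; intros s _; unfold weight; rewrite <- exp_plus; f_equal; ring.
Qed.

(** The hypotheses on H hold in a box of radius [N], and each use of superharmonicity costs one unit
    of it, since steps are small. [Lat] will be the set of displacements that can be realised both
    ways; no Lipschitz bound is asked elsewhere. *)
Lemma superharmonic_lower_bound (L : list (Z * Z)) (H : Z -> Z -> R) (Lat : Z -> Z -> Prop)
    (p q : Z) (N : nat) (a b K eps z : R) :
  (forall s, In s L -> -1 <= fst s <= 1 /\ -1 <= snd s <= 1)%Z ->
  lsum (fun s => weight a b s * IZR (fst s)) L = 0 ->
  lsum (fun s => weight a b s * IZR (snd s)) L = 0 ->
  0 < eps -> 0 <= K -> 0 < z -> 0 < lsum (weight a b) L -> 0 <= H p q ->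
  (forall s i j, In s L -> Lat i j -> Lat (i + fst s) (j + snd s))%Z ->
  (forall i j, (Z.abs i <= Z.of_nat N)%Z -> (Z.abs j <= Z.of_nat N)%Z -> Lat i j ->
     H p q * exp (- K * (Rabs (IZR i) + Rabs (IZR j))) <= H (p + i)%Z (q + j)%Z /\
     z * lsum (fun s => H (p + i + fst s)%Z (q + j + snd s)%Z) L <= H (p + i)%Z (q + j)%Z) ->
  forall k i j, (Z.abs i + Z.of_nat k <= Z.of_nat N)%Z ->
    (Z.abs j + Z.of_nat k <= Z.of_nat N)%Z -> Lat i j ->
    H p q * exp (barrier a b (K + Rabs a + Rabs b) eps (ln (z * lsum (weight a b) L))
                   k (IZR i) (IZR j)) <= H (p + i)%Z (q + j)%Z.
Proof.
  intros HL Hx Hy Heps HK Hz Hm HH HLat Hsup.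
  set (c := ln (z * lsum (weight a b) L)); set (K' := K + Rabs a + Rabs b).
  assert (HK' : 0 <= K') by (unfold K'; pose proof (Rabs_pos a); pose proof (Rabs_pos b); lra).
  assert (Hc : exp c = z * lsum (weight a b) L)
    by (apply exp_ln, Rmult_lt_0_compat; assumption).
  induction k as [|k IH]; intros i j Hi Hj Hij.
  - destruct (Hsup i j ltac:(lia) ltac:(lia) Hij) as [HS _].
    eapply Rle_trans; [|exact HS].
    apply Rmult_le_compat_l; [assumption|].
    now apply exp_le, barrier_base.
  - destruct (Hsup i j ltac:(lia) ltac:(lia) Hij) as [_ HS].
    eapply Rle_trans; [|exact HS].
    apply Rle_trans with (z * lsum (fun s => H p q *
       exp (barrier a b K' eps c k (IZR i + IZR (fst s)) (IZR j + IZR (snd s)))) L).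
    + rewrite lsum_scal.
      replace (exp (barrier a b K' eps c (S k) (IZR i) (IZR j)))
        with (exp c * exp (barrier a b K' eps c (S k) (IZR i) (IZR j) - c))
        by (rewrite <- exp_plus; f_equal; ring).
      rewrite Hc.
      pose proof (barrier_step L a b K' eps c (IZR i) (IZR j) k HL Hx Hy Heps HK') as HB.
      apply Rmult_le_compat_l with (r := z * H p q) in HB; [lra|].
      apply Rmult_le_pos; lra.
    + apply Rmult_le_compat_l; [lra|]; apply lsum_le; intros s Hs.
      rewrite <- !plus_IZR, <- !Z.add_assoc.
      destruct (HL s Hs) as [H1 H2].
      apply IH; [lia | lia | now apply HLat].
Qed.

Theorem returns_diverge (L : list (Z * Z)) (l : nat) (e f : Z * Z) (a b z : R) :
  step_basis L l e f ->
  (forall s, In s L -> -1 <= fst s <= 1 /\ -1 <= snd s <= 1)%Z ->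
  (exists j, In (1, j)%Z L) -> (exists j, In (-1, j)%Z L) ->
  (exists i, In (i, 1)%Z L) -> (exists i, In (i, -1)%Z L) ->
  In (1, 0)%Z L \/ In (0, 1)%Z L \/ In (1, 1)%Z L ->
  In (-1, 0)%Z L \/ In (0, -1)%Z L \/ In (-1, -1)%Z L ->
  lsum (fun s => weight a b s * IZR (fst s)) L = 0 ->
  lsum (fun s => weight a b s * IZR (snd s)) L = 0 ->
  0 < z -> 1 < z * lsum (weight a b) L ->
  ~ ex_series (fun n => INR (nb_returns L n 0 0) * z ^ n).
Proof.
  intros HB HL He Hw Hn Hs Hout Hin Hx Hy Hz Hzm Hex.
  change (ex_series (green_term L z 0 0)) in Hex.
  assert (Hm : 0 < lsum (weight a b) L) by (apply Rmult_lt_reg_l with z; lra).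
  set (c := ln (z * lsum (weight a b) L)).
  assert (Hc : 0 < c) by (unfold c; rewrite <- ln_1; apply ln_increasing; lra).
  (* Capping z at 1 makes z1^k nonincreasing in k. A unit of displacement takes at most l steps,
     each costing at most the factor z1; K below is the resulting Lipschitz constant of the log of
     the Green function. *)
  set (z1 := Rmin 1 z).
  assert (Hz1 : 0 < z1 /\ z1 <= 1 /\ z1 <= z).
  { unfold z1; pose proof (Rmin_l 1 z); pose proof (Rmin_r 1 z).
    split; [apply Rmin_glb_lt; lra | lra]. }
  set (K := - INR l * ln z1).
  assert (HK : 0 <= K).
  { unfold K; pose proof (pos_INR l).
    assert (ln z1 <= 0) by (rewrite <- ln_1; apply ln_le; lra); nra. }
  set (K' := K + Rabs a + Rabs b).
  assert (HK' : 0 <= K') by (unfold K'; pose proof (Rabs_pos a); pose proof (Rabs_pos b); lra).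
  (* Small enough that the barrier loses at most c/2 per time step; n is then taken so large that
     the remaining n c/2 exceeds the fixed loss K'/(2 eps). *)
  set (eps := c / (4 * (K' + 1))).
  assert (Heps : 0 < eps) by (apply Rdiv_lt_0_compat; lra).
  assert (HKe : 2 * K' * eps <= c / 2).
  { unfold eps; apply Rmult_le_reg_r with (4 * (K' + 1)); [lra|].
    replace (2 * K' * (c / (4 * (K' + 1))) * (4 * (K' + 1))) with (2 * K' * c) by (field; lra).
    nra. }
  destruct (archimed_cor1 (c / (2 * (K' / (2 * eps) + 1)))) as [n [Hn1 Hn2]].
  { apply Rdiv_lt_0_compat; [lra|].
    assert (0 <= K' / (2 * eps)); [|lra].
    apply Rmult_le_pos; [lra | left; apply Rinv_0_lt_compat; lra]. }
  assert (Hlarge : K' / (2 * eps) < c / 2 * INR n).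
  { assert (HKd : 0 <= K' / (2 * eps))
      by (apply Rmult_le_pos; [lra | left; apply Rinv_0_lt_compat; lra]).
    assert (Hnpos : 0 < INR n) by (apply lt_0_INR; lia).
    apply Rmult_lt_compat_r with (r := INR n * (K' / (2 * eps) + 1)) in Hn1; [|nra].
    rewrite <- Rmult_assoc, Rinv_l, Rmult_1_l in Hn1 by lra.
    replace (c / (2 * (K' / (2 * eps) + 1)) * (INR n * (K' / (2 * eps) + 1)))
      with (c / 2 * INR n) in Hn1 by (field; lra).
    lra. }
  (* A displacement in the box of radius n has at most 2n basis moves; since it can cost n of the
     margin, l + 3n leaves the required l + 2n at its far end. *)
  destruct (deep_recurrent_points L l e f (l + 3 * n + 1) HB HL He Hw Hn Hs Hout Hin)
    as [p [q [k1 [k2 [Hp [Hq [P1 P2]]]]]]].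
  destruct (green_qpath L z _ _ _ _ _ Hz P1 Hex) as [Hexp _].
  assert (Hgpos : 0 < green L z p q).
  { destruct (green_qpath L z _ _ _ _ _ Hz P2 Hexp) as [_ HG].
    eapply Rlt_le_trans; [|exact HG].
    apply Rmult_lt_0_compat; [now apply pow_lt|].
    unfold green; rewrite Series_incr_1 by assumption.
    assert (0 <= Series (fun k => green_term L z 0 0 (S k))).
    { apply series_nonneg; [intro; now apply green_term_pos|].
      now apply (ex_series_incr_1 (green_term L z 0 0)). }
    unfold green_term at 1; rewrite nb_returns_0; simpl; lra. }
  assert (Hmain : green L z p q * exp (barrier a b K' eps c n (IZR 0) (IZR 0))
                  <= green L z (p + 0) (q + 0)).
  { apply (superharmonic_lower_bound L (green L z) (in_lattice e f) p q n); auto.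
    - lra.
    - intros s i j Hs' Hij; now apply (in_lattice_step L l).
    - intros i j Hi Hj [x [y [-> ->]]].
      set (i := (x * fst e + y * fst f)%Z) in *; set (j := (x * snd e + y * snd f)%Z) in *.
      set (M := Z.to_nat (Z.abs x + Z.abs y)).
      pose proof (basis_norm _ _ _ _ HB x y) as HN; fold i j in HN.
      assert (HM : Z.of_nat M = (Z.abs x + Z.abs y)%Z) by (unfold M; lia).
      clearbody M.
      destruct (basis_path L l e f M x y p q HB) as [k [Hk P]]; [lia | lia | lia |].
      rewrite <- !Z.add_assoc in P; fold i j in P.
      (* Finiteness is known at (p, q) and must be carried away from it, hence the path in the
         opposite direction, with coordinates - x and - y. *)
      assert (Hex' : ex_series (green_term L z (p + i) (q + j))).
      { destruct (basis_path L l e f M (- x) (- y) (p + i) (q + j) HB) as [k' [_ P']];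
          [lia | lia | lia |].
        replace (p + i + - x * fst e + - y * fst f)%Z with p in P' by (unfold i; ring).
        replace (q + j + - x * snd e + - y * snd f)%Z with q in P' by (unfold j; ring).
        apply (green_qpath L z _ _ _ _ _ Hz P' Hexp). }
      split.
      + destruct (green_qpath L z _ _ _ _ _ Hz P Hex') as [_ HG].
        eapply Rle_trans; [|exact HG]; rewrite Rmult_comm.
        apply Rmult_le_compat_r; [lra|].
        apply Rle_trans with (z1 ^ k); [|apply pow_incr; lra].
        rewrite <- (exp_ln (z1 ^ k)) by (apply pow_lt; lra); apply exp_le.
        rewrite ln_pow by lra; unfold K.
        assert (Hln : ln z1 <= 0) by (rewrite <- ln_1; apply ln_le; lra).
        assert (HkN : INR k <= INR l * (Rabs (IZR i) + Rabs (IZR j))).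
        { apply Rle_trans with (INR (l * M)); [now apply le_INR|].
          rewrite mult_INR; apply Rmult_le_compat_l; [apply pos_INR|].
          rewrite INR_IZR_INZ, <- !abs_IZR, <- plus_IZR; apply IZR_le; lia. }
        nra.
      + apply green_super; [assumption | lia | lia | assumption].
    - lia.
    - lia.
    - exists 0%Z, 0%Z; lia. }
  rewrite !Z.add_0_r in Hmain.
  (* A positive barrier at the base point makes the positive number [green L z p q] strictly smaller
     than itself. *)
  assert (Hbar : 0 < barrier a b K' eps c n (IZR 0) (IZR 0)).
  { unfold barrier; simpl IZR.
    pose proof (pos_INR n).
    assert (2 * K' * eps * INR n <= c / 2 * INR n) by (apply Rmult_le_compat_r; lra).
    replace (K' * (/ (2 * eps) + eps * (0 ^ 2 + 0 ^ 2 + 2 * INR n)))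
      with (K' / (2 * eps) + 2 * K' * eps * INR n) by (unfold Rdiv; ring).
    lra. }
  apply exp_increasing in Hbar; rewrite exp_0 in Hbar.
  nra.
Qed.

(** * The minimum of the step polynomial *)

Definition ind (St : Z * Z -> bool) (i j : Z) : R := if St (i, j) then 1 else 0.

Definition rcoef (St : Z * Z -> bool) (i : Z) (y : R) : R :=
  ind St i (-1) + ind St i 0 * y + ind St i 1 * y ^ 2.

Lemma ind_nonneg (St : Z * Z -> bool) (i j : Z) : 0 <= ind St i j.
Proof. unfold ind; destruct (St (i, j)); lra. Qed.

Lemma delta_ind (St : Z * Z -> bool) (i j : Z) : delta St i j = RtoC (ind St i j).
Proof. unfold delta, ind; now destruct (St (i, j)). Qed.

Lemma branch_coef_RtoC (St : Z * Z -> bool) (i : Z) (y : R) :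
  branch_coef St i (RtoC y) = RtoC (rcoef St i y).
Proof.
  unfold branch_coef, rcoef; rewrite !delta_ind.
  now rewrite !RtoC_plus, !RtoC_mult, RtoC_pow.
Qed.

Lemma branch_coef_Cmod (St : Z * Z -> bool) (i : Z) (y : C) :
  Cmod (branch_coef St i y) <= rcoef St i (Cmod y).
Proof.
  unfold branch_coef, rcoef; rewrite !delta_ind.
  eapply Rle_trans; [apply Cmod_triangle|].
  rewrite Cmod_mult, Cmod_pow, Cmod_R, (Rabs_pos_eq (ind St i 1)) by apply ind_nonneg.
  apply Rplus_le_compat_r; eapply Rle_trans; [apply Cmod_triangle|].
  rewrite Cmod_mult, !Cmod_R, !Rabs_pos_eq by apply ind_nonneg; lra.
Qed.

Lemma rcoef_nonneg (St : Z * Z -> bool) (i : Z) (y : R) : 0 <= y -> 0 <= rcoef St i y.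
Proof.
  intro Hy; unfold rcoef.
  pose proof (ind_nonneg St i (-1)); pose proof (ind_nonneg St i 0);
  pose proof (ind_nonneg St i 1); nra.
Qed.

Lemma rcoef_mono (St : Z * Z -> bool) (i : Z) (y y' : R) :
  0 <= y <= y' -> rcoef St i y <= rcoef St i y'.
Proof.
  intro Hy; unfold rcoef.
  pose proof (ind_nonneg St i (-1)); pose proof (ind_nonneg St i 0);
  pose proof (ind_nonneg St i 1).
  assert (y ^ 2 <= y' ^ 2) by (apply pow_incr; lra); nra.
Qed.

Lemma rcoef_pos (St : Z * Z -> bool) (i : Z) (y : R) :
  is_model St -> (exists j, St (i, j) = true) -> 0 < y -> 0 < rcoef St i y.
Proof.
  intros HM [j Hj] Hy; unfold rcoef.
  pose proof (ind_nonneg St i (-1)); pose proof (ind_nonneg St i 0);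
  pose proof (ind_nonneg St i 1).
  assert (0 < y ^ 2) by now apply pow_lt.
  pose proof (step_list_small St (i, j) (proj1 (step_list_In St _ HM) Hj)) as [_ HJ].
  simpl in HJ.
  assert (j = -1 \/ j = 0 \/ j = 1)%Z as [E|[E|E]] by lia; subst;
    [assert (ind St i (-1) = 1) | assert (ind St i 0 = 1) | assert (ind St i 1 = 1)];
    try (unfold ind; now rewrite Hj); nra.
Qed.

Lemma d_tilde_RtoC (St : Z * Z -> bool) (y z : R) :
  z <> 0 -> d_tilde St (RtoC y) z =
  RtoC ((rcoef St 0 y - y / z) ^ 2 - 4 * rcoef St 1 y * rcoef St (-1) y).
Proof.
  intro Hz; unfold d_tilde, a_tilde, b_tilde, c_tilde; rewrite !branch_coef_RtoC.
  now rewrite RtoC_minus, RtoC_pow, RtoC_minus, RtoC_div, !RtoC_mult.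
Qed.

Definition step_sum (St : Z * Z -> bool) (a b : R) : R := lsum (weight a b) (step_list St).

Lemma lsum_filter {A : Type} (p : A -> bool) (f : A -> R) (l : list A) :
  lsum f (filter p l) = lsum (fun x => (if p x then 1 else 0) * f x) l.
Proof.
  induction l as [|x l IH]; [reflexivity|]; simpl.
  destruct (p x); simpl; rewrite IH; lra.
Qed.

Lemma step_sum_eq (St : Z * Z -> bool) (a b : R) :
  is_model St -> step_sum St a b =
  (rcoef St 1 (exp b) * exp a + rcoef St 0 (exp b) + rcoef St (-1) (exp b) / exp a) / exp b.
Proof.
  intro HM; unfold step_sum, step_list; rewrite lsum_filter.
  (* [rcoef St 0] would count a step (0, 0), which the list of steps does not contain. *)
  assert (H00 : ind St 0 0 = 0).
  { unfold ind; destruct (St (0, 0)%Z) eqn:E; [|reflexivity].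
    apply (small_steps _ HM) in E; simpl in E; intuition discriminate. }
  unfold rcoef; rewrite H00.
  unfold weight; cbn [lsum fold_right nonzero_small_steps fst snd].
  repeat match goal with |- context [if St (?i, ?j) then 1 else 0] =>
    change (if St (i, j) then 1 else 0) with (ind St i j) end.
  rewrite !exp_plus, !Rmult_1_l, !Rmult_0_l, exp_0.
  replace (exp (-1 * a)) with (/ exp a) by (rewrite <- exp_Ropp; f_equal; ring).
  replace (exp (-1 * b)) with (/ exp b) by (rewrite <- exp_Ropp; f_equal; ring).
  pose proof (exp_pos a); pose proof (exp_pos b).
  field; lra.
Qed.

(* [phi St b] is the minimum over a of [step_sum St a b]; the positive branch
   points are the y = exp b with phi = 1 / z. *)
Definition phi (St : Z * Z -> bool) (b : R) : R :=
  (rcoef St 0 (exp b) + 2 * sqrt (rcoef St 1 (exp b) * rcoef St (-1) (exp b))) / exp b.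

(** Equality case of A t + C/t >= 2 sqrt(A C), with t = exp a. *)
Definition phi_arg (St : Z * Z -> bool) (b : R) : R :=
  ln (sqrt (rcoef St (-1) (exp b) / rcoef St 1 (exp b))).

Lemma phi_le_step_sum (St : Z * Z -> bool) (a b : R) :
  is_model St -> phi St b <= step_sum St a b.
Proof.
  intro HM; rewrite step_sum_eq by assumption; unfold phi.
  pose proof (exp_pos a) as Ha; pose proof (exp_pos b) as Hb.
  apply Rmult_le_compat_r; [left; now apply Rinv_0_lt_compat|].
  pose proof (rcoef_nonneg St 1 (exp b) ltac:(lra)) as HA.
  pose proof (rcoef_nonneg St (-1) (exp b) ltac:(lra)) as HC.
  set (A := rcoef St 1 (exp b)) in *; set (C := rcoef St (-1) (exp b)) in *.
  set (u := A * exp a); set (v := C / exp a).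
  assert (Hu : 0 <= u) by (apply Rmult_le_pos; lra).
  assert (Hv : 0 <= v) by (apply Rmult_le_pos; [lra | left; now apply Rinv_0_lt_compat]).
  replace (A * C) with (u * v) by (unfold u, v; field; lra).
  rewrite sqrt_mult by assumption.
  pose proof (sqrt_sqrt u Hu); pose proof (sqrt_sqrt v Hv).
  pose proof (pow2_ge_0 (sqrt u - sqrt v)); nra.
Qed.

Lemma phi_attained (St : Z * Z -> bool) (b : R) :
  is_model St -> step_sum St (phi_arg St b) b = phi St b.
Proof.
  intro HM; rewrite step_sum_eq by assumption; unfold phi, phi_arg.
  pose proof (exp_pos b) as Hb.
  pose proof (rcoef_pos St 1 _ HM (has_east _ HM) Hb) as HA.
  pose proof (rcoef_pos St (-1) _ HM (has_west _ HM) Hb) as HC.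
  set (A := rcoef St 1 (exp b)) in *; set (C := rcoef St (-1) (exp b)) in *.
  rewrite exp_ln by (apply sqrt_lt_R0, Rdiv_lt_0_compat; assumption).
  rewrite sqrt_div, sqrt_mult by lra.
  pose proof (sqrt_lt_R0 A HA) as HA'; pose proof (sqrt_lt_R0 C HC) as HC'.
  assert (E1 : A * (sqrt C / sqrt A) = sqrt A * sqrt C).
  { rewrite <- (sqrt_sqrt A) at 1 by lra; field; lra. }
  assert (E2 : C / (sqrt C / sqrt A) = sqrt A * sqrt C).
  { rewrite <- (sqrt_sqrt C) at 1 by lra; field; lra. }
  rewrite E1, E2; f_equal; ring.
Qed.

Lemma phi_pos (St : Z * Z -> bool) (b : R) : is_model St -> 0 < phi St b.
Proof.
  intro HM; unfold phi; pose proof (exp_pos b) as Hb.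
  apply Rdiv_lt_0_compat; [|assumption].
  pose proof (rcoef_nonneg St 0 (exp b) ltac:(lra)).
  assert (0 < sqrt (rcoef St 1 (exp b) * rcoef St (-1) (exp b))); [|lra].
  apply sqrt_lt_R0, Rmult_lt_0_compat; apply rcoef_pos; auto;
    [apply (has_east _ HM) | apply (has_west _ HM)].
Qed.

Lemma exp_convex (x y t : R) :
  0 <= t <= 1 -> exp ((1 - t) * x + t * y) <= (1 - t) * exp x + t * exp y.
Proof.
  intro Ht; set (c := (1 - t) * x + t * y).
  replace (exp x) with (exp c * exp (x - c)) by (rewrite <- exp_plus; f_equal; ring).
  replace (exp y) with (exp c * exp (y - c)) by (rewrite <- exp_plus; f_equal; ring).
  pose proof (exp_ineq1_le (x - c)); pose proof (exp_ineq1_le (y - c)).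
  pose proof (exp_pos c).
  assert (H3 : 1 <= (1 - t) * exp (x - c) + t * exp (y - c)).
  { apply Rle_trans with ((1 - t) * (1 + (x - c)) + t * (1 + (y - c))).
    - right; unfold c; ring.
    - apply Rplus_le_compat; apply Rmult_le_compat_l; lra. }
  nra.
Qed.

(** Partial minimisation of a jointly convex function: test with the convex combination of the two
    minimising a. *)
Lemma phi_convex (St : Z * Z -> bool) (b b' t : R) :
  is_model St -> 0 <= t <= 1 ->
  phi St ((1 - t) * b + t * b') <= (1 - t) * phi St b + t * phi St b'.
Proof.
  intros HM Ht; rewrite <- !phi_attained by assumption.
  set (a := phi_arg St b); set (a' := phi_arg St b').
  rewrite phi_attained by assumption.
  apply Rle_trans with (step_sum St ((1 - t) * a + t * a') ((1 - t) * b + t * b'));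
    [now apply phi_le_step_sum|].
  unfold step_sum; rewrite <- !lsum_scal, <- lsum_plus.
  apply lsum_le; intros s _; unfold weight.
  replace (IZR (fst s) * ((1 - t) * a + t * a') + IZR (snd s) * ((1 - t) * b + t * b'))
    with ((1 - t) * (IZR (fst s) * a + IZR (snd s) * b)
          + t * (IZR (fst s) * a' + IZR (snd s) * b')) by ring.
  now apply exp_convex.
Qed.

Lemma phi_continuous (St : Z * Z -> bool) (b : R) : is_model St -> continuous (phi St) b.
Proof.
  intro HM.
  pose proof (exp_pos b) as Hb.
  pose proof (rcoef_pos St 1 _ HM (has_east _ HM) Hb) as HA.
  pose proof (rcoef_pos St (-1) _ HM (has_west _ HM) Hb) as HC.
  apply (ex_derive_continuous (phi St)); unfold phi, rcoef in *.
  auto_derive; split; [|lra].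
  apply Rmult_lt_0_compat; [exact HA | exact HC].
Qed.

(** For the pair s, t the multiples of a cancel, so their exponents average to at least e b / 2, and
    one of the two terms alone is large enough whatever a is. *)
Lemma straddles_bound (St : Z * Z -> bool) (e : Z) (b : R) :
  is_model St -> (e * e = 1)%Z -> straddles (step_list St) e = true -> 0 <= IZR e * b ->
  exp (IZR e * b / 2) <= phi St b.
Proof.
  intros HM He H Hb; rewrite <- phi_attained by assumption.
  set (a := phi_arg St b); unfold step_sum.
  assert (Hw : forall s, In s (step_list St) -> weight a b s <= lsum (weight a b) (step_list St)).
  { intros s Hs; apply lsum_ge_term; [intros; left; apply exp_pos | assumption]. }
  unfold straddles in H; apply orb_prop in H as [H|H].
  - apply zmem_In in H; eapply Rle_trans; [|apply (Hw _ H)].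
    unfold weight; simpl; apply exp_le; lra.
  - apply existsb_exists in H as [s [Hs H]]; apply andb_prop in H as [H1 H].
    apply existsb_exists in H as [t [Ht H]]; apply andb_prop in H as [H2 H3].
    apply Z.eqb_eq in H1, H2; apply Z.leb_le in H3; apply IZR_le in H3.
    rewrite mult_IZR, plus_IZR in H3.
    pose proof (Hw _ Hs) as Ws; pose proof (Hw _ Ht) as Wt.
    unfold weight in Ws, Wt at 1; rewrite H1 in Ws; rewrite H2 in Wt.
    set (E := lsum (weight a b) (step_list St)) in *.
    destruct (Rle_lt_dec (IZR e * b / 2) (IZR 1 * a + IZR (snd s) * b)) as [Hc|Hc].
    + eapply Rle_trans; [apply exp_le, Hc | exact Ws].
    + eapply Rle_trans; [|exact Wt]; apply exp_le.
      pose proof (Rmult_le_compat_r _ _ _ Hb H3) as H4.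
      replace (IZR e * (IZR (snd s) + IZR (snd t)) * (IZR e * b))
        with (IZR e * IZR e * ((IZR (snd s) + IZR (snd t)) * b)) in H4 by ring.
      rewrite <- mult_IZR, He in H4; lra.
Qed.

Lemma phi_minimum (St : Z * Z -> bool) :
  is_model St -> straddles (step_list St) 1 = true ->
  straddles (step_list St) (-1) = true ->
  exists b0, forall b, phi St b0 <= phi St b.
Proof.
  intros HM H1 H2.
  pose proof (phi_pos St 0 HM) as H0.
  (* Outside [-M, M] the bound exp(|b| / 2) exceeds phi(0) + 1, so the minimum over that interval is
     global. *)
  set (M := 2 * ln (phi St 0 + 1)).
  assert (HM0 : 0 < M).
  { unfold M; assert (ln 1 < ln (phi St 0 + 1)) by (apply ln_increasing; lra).
    rewrite ln_1 in *; lra. }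
  assert (HexpM : exp (M / 2) = phi St 0 + 1).
  { unfold M; replace (2 * ln (phi St 0 + 1) / 2) with (ln (phi St 0 + 1)) by field.
    apply exp_ln; lra. }
  destruct (continuity_ab_min (phi St) (- M) M) as [b0 [Hmin Hb0]]; [lra| |].
  { intros c _; apply continuity_pt_filterlim, phi_continuous, HM. }
  exists b0; intro b.
  destruct (Rle_lt_dec (Rabs b) M) as [Hb|Hb].
  - apply Hmin; now apply Rabs_le_between.
  - apply Rle_trans with (phi St 0); [apply Hmin; lra|].
    apply Rle_trans with (exp (M / 2)); [lra|].
    unfold Rabs in Hb; destruct (Rcase_abs b).
    + eapply Rle_trans; [|apply (straddles_bound St (-1) b HM eq_refl H2); lra].
      apply exp_le; lra.
    + eapply Rle_trans; [|apply (straddles_bound St 1 b HM eq_refl H1); lra].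
      apply exp_le; lra.
Qed.

(** * First-order conditions and uniqueness of the minimiser *)

(** From exp(-u) >= 1 - u, since (1 + u + 2 u^2)(1 - u) = 1 + u^2 (1 - 2 u) >= 1. *)
Lemma exp_le_quadratic (u : R) : Rabs u <= / 2 -> exp u <= 1 + u + 2 * u ^ 2.
Proof.
  intro Hu; apply Rabs_le_between in Hu.
  pose proof (exp_ineq1_le (- u)) as H; pose proof (exp_pos u) as Hp.
  rewrite exp_Ropp in H.
  apply Rmult_le_compat_l with (r := exp u) in H; [|lra].
  rewrite Rinv_r in H by lra.
  assert (1 <= (1 + u + 2 * u ^ 2) * (1 + - u)) by nra.
  nra.
Qed.

(** The directional derivative at a minimum is nonnegative; the quadratic bound on exp replaces
    differentiation, and |u| + |v| <= 1 keeps the exponents in its range. *)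
Lemma minimum_directional_drift (L : list (Z * Z)) (a b u v : R) :
  (forall s, In s L -> -1 <= fst s <= 1 /\ -1 <= snd s <= 1)%Z ->
  (forall a' b', lsum (weight a b) L <= lsum (weight a' b') L) ->
  Rabs u + Rabs v <= 1 ->
  0 <= lsum (fun s => weight a b s * (IZR (fst s) * u + IZR (snd s) * v)) L.
Proof.
  intros HL Hmin Huv.
  set (d := fun s : Z * Z => IZR (fst s) * u + IZR (snd s) * v).
  assert (Hd : forall s, In s L -> Rabs (d s) <= 1).
  { intros s Hs; destruct (HL s Hs) as [H1 H2].
    eapply Rle_trans; [apply Rabs_triang|]; rewrite !Rabs_mult, <- !abs_IZR.
    assert (IZR (Z.abs (fst s)) <= 1) by (apply IZR_le; lia).
    assert (IZR (Z.abs (snd s)) <= 1) by (apply IZR_le; lia).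
    pose proof (Rabs_pos u); pose proof (Rabs_pos v); nra. }
  set (m := lsum (weight a b) L).
  change (0 <= lsum (fun s => weight a b s * d s) L).
  assert (Hm : 0 <= m) by (apply lsum_nonneg; intros; left; apply exp_pos).
  destruct (Rle_lt_dec 0 (lsum (fun s => weight a b s * d s) L)) as [|Hneg]; [assumption|].
  set (D := lsum (fun s => weight a b s * d s) L) in *.
  assert (Ht : forall t, 0 < t <= / 2 -> 0 <= t * D + 2 * t ^ 2 * m).
  { intros t Ht.
    assert (H : lsum (weight (a + t * u) (b + t * v)) L <= m + t * D + 2 * t ^ 2 * m).
    { unfold m at 1 2, D; rewrite <- !lsum_scal, <- !lsum_plus.
      apply lsum_le; intros s Hs.
      replace (weight (a + t * u) (b + t * v) s) with (weight a b s * exp (t * d s))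
        by (unfold weight, d; rewrite <- exp_plus; f_equal; ring).
      specialize (Hd s Hs).
      assert (Hw : 0 < weight a b s) by apply exp_pos.
      apply Rle_trans with (weight a b s * (1 + t * d s + 2 * (t * d s) ^ 2)).
      - apply Rmult_le_compat_l; [lra|]; apply exp_le_quadratic.
        rewrite Rabs_mult, (Rabs_pos_eq t) by lra; pose proof (Rabs_pos (d s)); nra.
      - assert ((d s) ^ 2 <= 1).
        { rewrite <- pow2_abs; pose proof (Rabs_pos (d s)); nra. }
        assert (weight a b s * (2 * t ^ 2 * d s ^ 2) <= weight a b s * (2 * t ^ 2 * 1)).
        { apply Rmult_le_compat_l; [lra|]; apply Rmult_le_compat_l; [nra | lra]. }
        nra. }
    pose proof (Hmin (a + t * u) (b + t * v)) as H'; fold m in H'; lra. }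
  exfalso.
  (* Small enough for the negative t D to outweigh 2 t^2 m. *)
  set (t := Rmin (/ 2) (- D / (4 * (m + 1)))).
  assert (HDm : 0 < - D / (4 * (m + 1))) by (apply Rdiv_lt_0_compat; lra).
  assert (Ht0 : 0 < t) by (unfold t; apply Rmin_glb_lt; lra).
  assert (Ht1 : t <= / 2) by apply Rmin_l.
  assert (Ht2 : t * (4 * (m + 1)) <= - D).
  { apply Rle_trans with (- D / (4 * (m + 1)) * (4 * (m + 1))).
    - apply Rmult_le_compat_r; [lra | apply Rmin_r].
    - right; field; lra. }
  specialize (Ht t (conj Ht0 Ht1)).
  nra.
Qed.

Lemma minimum_drift_zero (L : list (Z * Z)) (a b : R) :
  (forall s, In s L -> -1 <= fst s <= 1 /\ -1 <= snd s <= 1)%Z ->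
  (forall a' b', lsum (weight a b) L <= lsum (weight a' b') L) ->
  lsum (fun s => weight a b s * IZR (fst s)) L = 0 /\
  lsum (fun s => weight a b s * IZR (snd s)) L = 0.
Proof.
  intros HL Hmin.
  assert (H : forall u v, Rabs u + Rabs v <= 1 ->
    0 <= u * lsum (fun s => weight a b s * IZR (fst s)) L
         + v * lsum (fun s => weight a b s * IZR (snd s)) L).
  { intros u v Huv.
    eapply Rle_trans; [apply (minimum_directional_drift L a b u v HL Hmin Huv)|].
    rewrite <- !lsum_scal, <- lsum_plus; right.
    apply lsum_ext; intros; ring. }
  assert (R1 : Rabs (-1) = 1) by (rewrite Rabs_left; lra).
  pose proof (H 1 0 ltac:(rewrite Rabs_R1, Rabs_R0; lra)).
  pose proof (H (-1) 0 ltac:(rewrite R1, Rabs_R0; lra)).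
  pose proof (H 0 1 ltac:(rewrite Rabs_R1, Rabs_R0; lra)).
  pose proof (H 0 (-1) ltac:(rewrite R1, Rabs_R0; lra)).
  lra.
Qed.

(** As the drift vanishes at the minimiser, phi(b) - phi(b0) is the weighted sum of exp(u) - 1 - u.
    If it is not positive, every u(s) is 0: the displacement of the minimiser is orthogonal to all
    steps, and [straddles] forces b = b0. *)
Lemma phi_strict_minimum (St : Z * Z -> bool) (b0 b : R) :
  is_model St -> straddles (step_list St) 1 = true ->
  (forall b, phi St b0 <= phi St b) -> b <> b0 -> phi St b0 < phi St b.
Proof.
  intros HM H1 Hmin Hb; destruct (Rle_lt_dec (phi St b) (phi St b0)) as [Hle|]; [exfalso|assumption].
  set (a0 := phi_arg St b0); set (a := phi_arg St b).
  pose proof (phi_attained St b0 HM) as E0; fold a0 in E0; unfold step_sum in E0.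
  pose proof (phi_attained St b HM) as E; fold a in E; unfold step_sum in E.
  destruct (minimum_drift_zero (step_list St) a0 b0) as [D1 D2].
  { intros; now apply (step_list_small St). }
  { intros a' b'; rewrite E0; eapply Rle_trans; [apply Hmin|].
    now apply (phi_le_step_sum St). }
  set (u := fun s : Z * Z => IZR (fst s) * (a - a0) + IZR (snd s) * (b - b0)).
  set (g := fun s => weight a0 b0 s * (exp (u s) - (1 + u s))).
  assert (Hg : forall s, 0 <= g s).
  { intro s; unfold g; apply Rmult_le_pos; [left; apply exp_pos|].
    pose proof (exp_ineq1_le (u s)); lra. }
  assert (Eg : lsum g (step_list St) <= 0).
  { replace (lsum g (step_list St)) with
      (lsum (weight a b) (step_list St) + -1 * lsum (weight a0 b0) (step_list St)
       + - (a - a0) * lsum (fun s => weight a0 b0 s * IZR (fst s)) (step_list St)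
       + - (b - b0) * lsum (fun s => weight a0 b0 s * IZR (snd s)) (step_list St)).
    - rewrite E, E0, D1, D2; lra.
    - rewrite <- !lsum_scal, <- !lsum_plus; apply lsum_ext; intros s _; unfold g.
      replace (weight a b s) with (weight a0 b0 s * exp (u s))
        by (unfold weight, u; rewrite <- exp_plus; f_equal; ring).
      unfold u; ring. }
  assert (Hu : forall s, In s (step_list St) -> u s = 0).
  { intros s Hs.
    pose proof (lsum_ge_term g (step_list St) s ltac:(auto) Hs) as Hgs.
    destruct (Req_dec (u s) 0) as [|Hn]; [assumption|exfalso].
    apply exp_ineq1 in Hn.
    assert (0 < g s) by (apply Rmult_lt_0_compat; [apply exp_pos | lra]); lra. }
  unfold straddles in H1; apply orb_prop in H1 as [H|H].
  - apply zmem_In, Hu in H; unfold u in H; simpl in H; lra.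
  - apply existsb_exists in H as [s [Hs H]]; apply andb_prop in H as [H1 H].
    apply existsb_exists in H as [t [Ht H]]; apply andb_prop in H as [H2 H3].
    apply Z.eqb_eq in H1, H2; apply Z.leb_le in H3; apply IZR_le in H3.
    rewrite mult_IZR, plus_IZR in H3.
    apply Hu in Hs, Ht; unfold u in Hs, Ht; rewrite H1 in Hs; rewrite H2 in Ht.
    assert (E2 : (IZR (snd s) + IZR (snd t)) * (b - b0) = 0) by lra.
    apply Rmult_integral in E2 as [E2|E2]; lra.
Qed.

Lemma phi_strictly_monotone (St : Z * Z -> bool) (b0 b t : R) :
  is_model St -> straddles (step_list St) 1 = true ->
  (forall b, phi St b0 <= phi St b) -> b <> b0 -> 0 < t <= 1 ->
  phi St ((1 - t) * b + t * b0) < phi St b.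
Proof.
  intros HM H1 Hmin Hb Ht.
  pose proof (phi_strict_minimum St b0 b HM H1 Hmin Hb).
  pose proof (phi_convex St b b0 t HM ltac:(lra)).
  nra.
Qed.

(** * Roots of the discriminant on circles *)

Definition discriminant (St : Z * Z -> bool) (b z : R) : R :=
  (rcoef St 0 (exp b) - exp b / z) ^ 2 - 4 * rcoef St 1 (exp b) * rcoef St (-1) (exp b).

(** A difference of squares, with 4 A C as the square of 2 sqrt(A C); the first bracket vanishes
    exactly on the curve z = 1/phi. *)
Lemma discriminant_eq (St : Z * Z -> bool) (b z : R) :
  0 < z -> discriminant St b z =
  exp b ^ 2 * (/ z - phi St b) *
  (/ z - phi St b + 4 * sqrt (rcoef St 1 (exp b) * rcoef St (-1) (exp b)) / exp b).
Proof.
  intro Hz; unfold discriminant, phi; pose proof (exp_pos b) as Hb.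
  pose proof (rcoef_nonneg St 1 (exp b) ltac:(lra)).
  pose proof (rcoef_nonneg St (-1) (exp b) ltac:(lra)).
  set (A := rcoef St 1 (exp b)) in *; set (C := rcoef St (-1) (exp b)) in *.
  replace (4 * A * C) with (4 * (sqrt (A * C) * sqrt (A * C)))
    by (rewrite sqrt_sqrt; [ring | now apply Rmult_le_pos]).
  field; lra.
Qed.

Lemma discriminant_zero (St : Z * Z -> bool) (b z : R) :
  0 < z -> / z = phi St b -> d_tilde St (RtoC (exp b)) z = RtoC 0.
Proof.
  intros Hz E; rewrite d_tilde_RtoC by lra.
  change (RtoC (discriminant St b z) = RtoC 0).
  rewrite discriminant_eq, E by assumption; f_equal; ring.
Qed.

(** Let p, A, C be the coefficient polynomials. As their coefficients are nonnegative, |y/z - p(y)|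
    >= |y|/z - p(|y|) > 2 sqrt(A(|y|) C(|y|)), and the square of the last term is at least |4 A(y)
    C(y)|. *)
Lemma circle_no_root (St : Z * Z -> bool) (b z : R) (y : C) :
  0 < z -> phi St b < / z -> Cmod y = exp b -> d_tilde St y z <> RtoC 0.
Proof.
  intros Hz Hphi Hy H.
  pose proof (exp_pos b) as Hb.
  unfold d_tilde, a_tilde, b_tilde, c_tilde in H.
  set (p := branch_coef St 0 y) in *; set (A := branch_coef St 1 y) in *.
  set (C := branch_coef St (-1) y) in *.
  assert (Hz0 : RtoC z <> RtoC 0) by (intro E; apply RtoC_inj in E; lra).
  assert (E : ((y / RtoC z - p) ^ 2 = 4 * A * C)%C).
  { replace ((y / RtoC z - p) ^ 2)%C with ((p - y / RtoC z) ^ 2 - 4 * A * C + 4 * A * C)%C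
      by ring.
    rewrite H; ring. }
  apply (f_equal Cmod) in E.
  rewrite Cmod_pow, !Cmod_mult, Cmod_R, (Rabs_pos_eq 4) in E by lra.
  pose proof (branch_coef_Cmod St 0 y) as H0; fold p in H0.
  pose proof (branch_coef_Cmod St 1 y) as H1; fold A in H1.
  pose proof (branch_coef_Cmod St (-1) y) as H2; fold C in H2.
  rewrite Hy in H0, H1, H2.
  assert (H3 : exp b / z - rcoef St 0 (exp b) <= Cmod (y / RtoC z - p)%C).
  { assert (H4 : Cmod (y / RtoC z)%C <= Cmod (y / RtoC z - p)%C + Cmod p).
    { replace (y / RtoC z)%C with ((y / RtoC z - p) + p)%C at 1 by ring.
      apply Cmod_triangle. }
    rewrite Cmod_div, Hy, Cmod_R, (Rabs_pos_eq z) in H4 by (assumption || lra); lra. }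
  unfold phi in Hphi.
  pose proof (rcoef_nonneg St 1 (exp b) ltac:(lra)) as HA.
  pose proof (rcoef_nonneg St (-1) (exp b) ltac:(lra)) as HC.
  set (rA := rcoef St 1 (exp b)) in *; set (rC := rcoef St (-1) (exp b)) in *.
  assert (H5 : 2 * sqrt (rA * rC) < exp b / z - rcoef St 0 (exp b)).
  { apply Rmult_lt_compat_r with (r := exp b) in Hphi; [|assumption].
    unfold Rdiv in Hphi; rewrite Rmult_assoc, Rinv_l, Rmult_1_r in Hphi by lra.
    unfold Rdiv; lra. }
  pose proof (sqrt_pos (rA * rC)) as H6.
  pose proof (sqrt_sqrt (rA * rC) ltac:(now apply Rmult_le_pos)) as H7.
  pose proof (Cmod_ge_0 A) as HcA; pose proof (Cmod_ge_0 C) as HcC.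
  assert (HAC : Cmod A * Cmod C <= rA * rC) by (apply Rmult_le_compat; assumption).
  set (X := Cmod (y / RtoC z - p)%C) in *.
  nra.
Qed.

(** * Continuation of the branch points *)

Lemma no_zero_sign (u : R -> R) (l h x0 x : R) :
  (forall t, l < t < h -> continuous u t) -> (forall t, l < t < h -> u t <> 0) ->
  l < x0 < h -> l < x < h -> u x0 < 0 -> u x < 0.
Proof.
  intros Hc Hn H0 H Hneg.
  assert (Hcp : forall t, l < t < h -> continuity_pt u t).
  { intros t Ht; apply continuity_pt_filterlim, Hc, Ht. }
  destruct (Rtotal_order (u x) 0) as [|[Hz|Hpos]]; [assumption | now apply Hn in Hz |].
  exfalso; destruct (Rtotal_order x0 x) as [Hlt|[Heq|Hgt]].
  - destruct (IVT_interv u x0 x) as [t [Ht Et]]; auto.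
    + intros t Ht; apply Hcp; lra.
    + apply (Hn t); [lra | assumption].
  - subst; lra.
  - destruct (IVT_interv (opp_fct u) x x0) as [t [Ht Et]]; auto.
    + intros t Ht; apply continuity_pt_opp, Hcp; lra.
    + unfold opp_fct; lra.
    + unfold opp_fct; lra.
    + unfold opp_fct in Et; apply (Hn t); lra.
Qed.

Lemma continuous_Cmod (f : R -> C) (t : R) :
  continuous f t -> continuous (fun t => Cmod (f t)) t.
Proof.
  intro H; apply (continuous_comp f Cmod); [exact H|].
  apply (filterlim_norm (K := C_AbsRing) (V := C_NormedModule)).
Qed.

Lemma continuous_RtoC (f : R -> R) (t : R) :
  continuous f t -> continuous (fun t => RtoC (f t)) t.
Proof.
  intro H; apply (continuous_comp f RtoC); [exact H|].
  apply filterlim_locally; intro eps; exists eps; intros x Hx.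
  split; [exact Hx | apply ball_center].
Qed.

Lemma continuous_Cmod_minus (f g : R -> C) (t : R) :
  continuous f t -> continuous g t -> continuous (fun t => Cmod (f t - g t)%C) t.
Proof.
  intros Hf Hg; apply (continuous_Cmod (fun t => f t - g t)%C).
  exact (continuous_minus (V := C_NormedModule) f g t Hf Hg).
Qed.

Lemma exp_lipschitz (u v B : R) :
  exp u <= B -> exp v <= B -> Rabs (exp u - exp v) <= B * Rabs (u - v).
Proof.
  intros Hu Hv.
  assert (H : forall a b, exp a - exp b <= exp a * (a - b)).
  { intros a b; replace (exp b) with (exp a * exp (b - a)) by (rewrite <- exp_plus; f_equal; ring).
    pose proof (exp_ineq1_le (b - a)); pose proof (exp_pos a); nra. }
  pose proof (H u v) as H1; pose proof (H v u) as H2.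
  pose proof (exp_pos u); pose proof (exp_pos v).
  pose proof (Rabs_pos (u - v)).
  assert (exp u * (u - v) <= B * Rabs (u - v)).
  { apply Rle_trans with (exp u * Rabs (u - v)).
    - apply Rmult_le_compat_l; [lra | apply Rle_abs].
    - apply Rmult_le_compat_r; lra. }
  assert (exp v * (v - u) <= B * Rabs (u - v)).
  { apply Rle_trans with (exp v * Rabs (u - v)).
    - apply Rmult_le_compat_l; [lra|]; rewrite Rabs_minus_sym; apply Rle_abs.
    - apply Rmult_le_compat_r; lra. }
  apply Rabs_le; lra.
Qed.

(* A double root would make d_tilde quadratically small near exp b, whereas
   convexity of phi makes it decrease linearly towards the minimiser b0. *)
Lemma no_double_root (St : Z * Z -> bool) (b0 b : R) (q : C -> C) :
  is_model St -> straddles (step_list St) 1 = true ->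
  (forall b, phi St b0 <= phi St b) -> b <> b0 ->
  (forall y, d_tilde St y (/ phi St b) = ((y - RtoC (exp b)) ^ 2 * q y)%C) ->
  (forall B, exists M, forall y : R, Rabs y <= B -> Cmod (q (RtoC y)) <= M) -> False.
Proof.
  intros HM H1 Hmin Hb Hq Hbound.
  pose proof (phi_pos St b HM) as Hphi.
  assert (Hz : 0 < / phi St b) by now apply Rinv_0_lt_compat.
  set (B := Rmax (exp b) (exp b0)); set (m := Rmin (exp b) (exp b0)).
  assert (Hm : 0 < m) by (apply Rmin_glb_lt; apply exp_pos).
  assert (HB : exp b <= B /\ exp b0 <= B) by (split; [apply Rmax_l | apply Rmax_r]).
  assert (Hmb : m <= exp b /\ m <= exp b0) by (split; [apply Rmin_l | apply Rmin_r]).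
  destruct (Hbound B) as [M HMb].
  set (delta := phi St b - phi St b0).
  assert (Hdelta : 0 < delta)
    by (unfold delta; pose proof (phi_strict_minimum St b0 b HM H1 Hmin Hb); lra).
  (* Lower bound, uniform on the segment from b to b0, for the square root in [discriminant_eq]; the
     coefficients are monotone in y. *)
  set (kappa := sqrt (rcoef St 1 m * rcoef St (-1) m)).
  assert (Hkappa : 0 < kappa).
  { apply sqrt_lt_R0, Rmult_lt_0_compat; apply rcoef_pos; auto;
      [apply (has_east _ HM) | apply (has_west _ HM)]. }
  set (c := 4 * delta * m * kappa).
  assert (Hc : 0 < c) by (unfold c; repeat apply Rmult_lt_0_compat; lra).
  set (K := (B * Rabs (b0 - b)) ^ 2 * (Rabs M + 1)).
  assert (HK : 0 <= K).
  { apply Rmult_le_pos; [apply pow2_ge_0 | pose proof (Rabs_pos M); lra]. }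
  assert (Hineq : forall s, 0 < s <= 1 -> c * s <= K * s ^ 2).
  { intros s Hs; set (bs := (1 - s) * b + s * b0).
    assert (Hbs : m <= exp bs <= B).
    { destruct (Rle_lt_dec b b0) as [Hle|Hlt].
      - split; [apply Rle_trans with (exp b) | apply Rle_trans with (exp b0)];
          try tauto; apply exp_le; unfold bs; nra.
      - split; [apply Rle_trans with (exp b0) | apply Rle_trans with (exp b)];
          try tauto; apply exp_le; unfold bs; nra. }
    pose proof (phi_convex St b b0 s HM ltac:(lra)) as Hconv; fold bs in Hconv.
    assert (Hgap : s * delta <= phi St b - phi St bs) by (unfold delta; lra).
    assert (Hlow : c * s <= discriminant St bs (/ phi St b)).
    { rewrite discriminant_eq, Rinv_inv by assumption.
      assert (Hk : kappa <= sqrt (rcoef St 1 (exp bs) * rcoef St (-1) (exp bs))).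
      { apply sqrt_le_1_alt, Rmult_le_compat;
          try (apply rcoef_nonneg; lra); apply rcoef_mono; lra. }
      set (w := sqrt (rcoef St 1 (exp bs) * rcoef St (-1) (exp bs))) in *.
      set (g := phi St b - phi St bs) in *.
      assert (Hg0 : 0 < s * delta) by (apply Rmult_lt_0_compat; lra).
      replace (exp bs ^ 2 * g * (g + 4 * w / exp bs))
        with (exp bs ^ 2 * g ^ 2 + 4 * g * (exp bs * w)) by (field; lra).
      assert (m * kappa <= exp bs * w) by (apply Rmult_le_compat; lra).
      assert (H6 : (4 * (s * delta)) * (m * kappa) <= (4 * g) * (exp bs * w)).
      { apply Rmult_le_compat; try lra; apply Rmult_le_pos; lra. }
      pose proof (pow2_ge_0 (exp bs * g)); unfold c; nra. }
    assert (Hup : discriminant St bs (/ phi St b) <= K * s ^ 2).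
    { apply Rle_trans with (Cmod (d_tilde St (RtoC (exp bs)) (/ phi St b))).
      - rewrite d_tilde_RtoC, Cmod_R by lra; apply Rle_abs.
      - rewrite Hq, Cmod_mult, Cmod_pow, <- RtoC_minus, Cmod_R.
        replace (K * s ^ 2) with ((B * (Rabs (b0 - b) * s)) ^ 2 * (Rabs M + 1))
          by (unfold K; ring).
        apply Rmult_le_compat; [apply pow_le, Rabs_pos | apply Cmod_ge_0 | |].
        + apply pow_incr; split; [apply Rabs_pos|].
          replace (Rabs (b0 - b) * s) with (Rabs (bs - b)).
          * apply exp_lipschitz; tauto.
          * replace (bs - b) with ((b0 - b) * s) by (unfold bs; ring).
            rewrite Rabs_mult, (Rabs_pos_eq s); lra.
        + apply Rle_trans with M; [|pose proof (Rle_abs M); lra].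
          apply HMb; rewrite Rabs_pos_eq; lra. }
    lra. }
  (* At this s the quadratic upper bound falls below the linear lower bound. *)
  set (s := Rmin 1 (c / (2 * (K + 1)))).
  assert (Hs : 0 < s).
  { unfold s; apply Rmin_glb_lt; [lra | apply Rdiv_lt_0_compat; lra]. }
  assert (Hs1 : s <= 1) by apply Rmin_l.
  assert (Hs2 : s * (2 * (K + 1)) <= c).
  { apply Rle_trans with (c / (2 * (K + 1)) * (2 * (K + 1))).
    - apply Rmult_le_compat_r; [lra | apply Rmin_r].
    - right; field; lra. }
  specialize (Hineq s (conj Hs Hs1)); nra.
Qed.

(** Moving from b towards b0 takes phi strictly below 1/z = phi(b), the regime of
    [circle_no_root]. *)
Lemma no_root_between (St : Z * Z -> bool) (b0 b c : R) :
  is_model St -> straddles (step_list St) 1 = true ->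
  (forall b, phi St b0 <= phi St b) -> b < c <= b0 \/ b0 <= c < b ->
  d_tilde St (RtoC (exp c)) (/ phi St b) <> RtoC 0.
Proof.
  intros HM H1 Hmin Hc; pose proof (phi_pos St b HM) as Hphi.
  assert (Hb : b - b0 <> 0) by lra.
  apply circle_no_root with c.
  - now apply Rinv_0_lt_compat.
  - rewrite Rinv_inv.
    set (t := (c - b) / (b0 - b)).
    replace c with ((1 - t) * b + t * b0) by (unfold t; field; lra).
    apply phi_strictly_monotone; auto; [lra|]; unfold t; destruct Hc as [Hc|Hc].
    + split; [apply Rdiv_lt_0_compat; lra|].
      apply Rmult_le_reg_r with (b0 - b); [lra|]; field_simplify; lra.
    + replace ((c - b) / (b0 - b)) with ((b - c) / (b - b0)) by (field; lra).
      split; [apply Rdiv_lt_0_compat; lra|].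
      apply Rmult_le_reg_r with (b - b0); [lra|]; field_simplify; lra.
  - rewrite Cmod_R, Rabs_pos_eq; [reflexivity | left; apply exp_pos].
Qed.

(* The curve b = b0 + s t, z = 1 / phi b parametrises one real branch; the label
   f cannot jump to g along it. *)
Lemma branch_tracking (St : Z * Z -> bool) (b0 s T : R) (f g : R -> C) :
  is_model St ->
  (forall z, 0 < z -> continuous f z) -> (forall z, 0 < z -> continuous g z) ->
  (forall t, 0 < t -> RtoC (exp (b0 + s * t)) = f (/ phi St (b0 + s * t)) \/
                      RtoC (exp (b0 + s * t)) = g (/ phi St (b0 + s * t))) ->
  (forall t, 0 < t -> RtoC (exp (b0 + s * t)) = f (/ phi St (b0 + s * t)) ->
                      RtoC (exp (b0 + s * t)) = g (/ phi St (b0 + s * t)) -> False) ->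
  0 < T -> RtoC (exp (b0 + s * T)) = f (/ phi St (b0 + s * T)) ->
  f (/ phi St b0) = RtoC (exp b0).
Proof.
  intros HM Hf Hg Hor Hnot HT ET.
  set (e := fun t => RtoC (exp (b0 + s * t))).
  set (z := fun t => / phi St (b0 + s * t)).
  assert (Hlin : forall t, continuous (fun t => b0 + s * t) t).
  { intro t; apply (ex_derive_continuous (fun t => b0 + s * t)); auto_derive; trivial. }
  assert (Hz : forall t, continuous z t).
  { intro t; unfold z; apply continuous_Rinv_comp.
    - apply (continuous_comp (fun t => b0 + s * t) (phi St)); [apply Hlin | now apply phi_continuous].
    - pose proof (phi_pos St (b0 + s * t) HM); lra. }
  assert (Hzpos : forall t, 0 < z t) by (intro t; apply Rinv_0_lt_compat, phi_pos, HM).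
  assert (He : forall t, continuous e t).
  { intro t; apply continuous_RtoC.
    apply (ex_derive_continuous (fun t => exp (b0 + s * t))); auto_derive; trivial. }
  assert (HF : forall t, continuous (fun t => Cmod (f (z t) - e t)%C) t).
  { intro t; apply (continuous_Cmod_minus (fun t => f (z t)) e); [|apply He].
    apply (continuous_comp z f); auto. }
  assert (HG : forall t, continuous (fun t => Cmod (g (z t) - e t)%C) t).
  { intro t; apply (continuous_Cmod_minus (fun t => g (z t)) e); [|apply He].
    apply (continuous_comp z g); auto. }
  assert (HC0 : forall x y : C, Cmod (x - y)%C = 0 -> y = x).
  { intros x y H; apply Cmod_eq_0 in H.
    replace x with ((x - y) + y)%C by ring; rewrite H; ring. }
  assert (HCe : forall x y : C, y = x -> Cmod (x - y)%C = 0).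
  { intros x y ->; unfold Cminus; rewrite Cplus_opp_r; apply Cmod_0. }
  assert (Htrack : forall t, 0 < t -> Cmod (f (z t) - e t)%C = 0).
  { intros t Ht.
    (* Negative where f alone is on the curve, positive where g alone is; a zero would put both
       labels on it. *)
    set (u := fun t => Cmod (f (z t) - e t)%C - Cmod (g (z t) - e t)%C).
    assert (Hu : u t < 0).
    { apply (no_zero_sign u 0 (t + T + 1) T t); try lra.
      - intros r _; apply (continuous_minus (V := R_NormedModule)); [apply HF | apply HG].
      - intros r [Hr _] E; unfold u in E.
        destruct (Hor r Hr) as [E1|E1].
        + pose proof (HCe _ _ E1 : Cmod (f (z r) - e r)%C = 0) as E2.
          apply (Hnot r Hr E1), HC0; change (Cmod (g (z r) - e r)%C = 0); lra.
        + pose proof (HCe _ _ E1 : Cmod (g (z r) - e r)%C = 0) as E2.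
          apply (Hnot r Hr); [|exact E1].
          apply HC0; change (Cmod (f (z r) - e r)%C = 0); lra.
      - unfold u.
        pose proof (HCe _ _ ET : Cmod (f (z T) - e T)%C = 0) as E1; rewrite E1.
        destruct (Cmod_ge_0 (g (z T) - e T)%C) as [|E2]; [lra|].
        exfalso; apply (Hnot T HT ET), HC0; symmetry; exact E2. }
    destruct (Hor t Ht) as [E|E]; [now apply HCe|].
    pose proof (HCe _ _ E : Cmod (g (z t) - e t)%C = 0).
    unfold u in Hu; pose proof (Cmod_ge_0 (f (z t) - e t)%C); lra. }
  assert (H0 : Cmod (f (z 0) - e 0)%C = 0).
  { destruct (Req_dec (Cmod (f (z 0) - e 0)%C) 0) as [|Hne]; [assumption|exfalso].
    pose proof (HF 0) as Hc; apply continuity_pt_filterlim in Hc.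
    destruct (Hc (Cmod (f (z 0) - e 0)%C)) as [d [Hd Hlim]].
    { pose proof (Cmod_ge_0 (f (z 0) - e 0)%C); lra. }
    specialize (Hlim (d / 2)); simpl in Hlim; unfold R_dist in Hlim.
    rewrite (Htrack (d / 2)) in Hlim by lra.
    rewrite Rminus_0_l, Rabs_Ropp, (Rabs_pos_eq (Cmod _)) in Hlim by apply Cmod_ge_0.
    apply (Rlt_irrefl (Cmod (f (z 0) - e 0)%C)), Hlim; split.
    - unfold D_x, no_cond; split; [trivial | lra].
    - rewrite Rminus_0_r, Rabs_pos_eq; lra. }
  apply HC0 in H0; unfold z, e in H0.
  rewrite Rmult_0_r, Rplus_0_r in H0; now symmetry.
Qed.

Lemma Cmult_integral (x y : C) : (x * y)%C = RtoC 0 -> x = RtoC 0 \/ y = RtoC 0.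
Proof.
  intro H; apply (f_equal Cmod) in H; rewrite Cmod_mult, Cmod_0 in H.
  apply Rmult_integral in H as [H|H]; apply Cmod_eq_0 in H; auto.
Qed.

Lemma d_tilde_root_iff (St : Z * Z -> bool) (y1 y2 y3 : R -> C) (y4 : option (R -> C))
    (z : R) (y : C) :
  branch_points St y1 y2 y3 y4 -> 0 < z ->
  d_tilde St y z = RtoC 0 <->
  (y = y1 z \/ y = y2 z \/ y = y3 z \/ exists f, y4 = Some f /\ y = f z).
Proof.
  intros hy Hz; destruct (roots_d_tilde _ _ _ _ _ hy z Hz) as [k [Hk Hd]].
  assert (Hsub : forall a b : C, (a - b)%C = RtoC 0 -> a = b).
  { intros a b H; replace a with ((a - b) + b)%C by ring; rewrite H; ring. }
  rewrite Hd; split.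
  - intro H; apply Cmult_integral in H as [H|H].
    + apply Cmult_integral in H as [H|H]; [|auto].
      apply Cmult_integral in H as [H|H]; [|auto].
      apply Cmult_integral in H as [H|H]; [contradiction | auto].
    + destruct y4 as [f|]; simpl in H.
      * right; right; right; exists f; auto.
      * apply RtoC_inj in H; lra.
  - intros [H|[H|[H|[f [H4 H]]]]]; subst; simpl; ring.
Qed.

(** Otherwise y^2 divides the discriminant. For small z only [y1] can vanish, because 0 < y2 and 1 <
    y3 <= |y4|, so 0 would be at most a simple root. *)
Lemma negative_step (St : Z * Z -> bool) (y1 y2 y3 : R -> C) (y4 : option (R -> C)) :
  is_model St -> branch_points St y1 y2 y3 y4 ->
  exists i j, St (i, j) = true /\ (i + j < 0)%Z.
Proof.
  intros HM hy; apply NNPP; intro Hno.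
  assert (Hz : forall i j, (i + j < 0)%Z -> delta St i j = RtoC 0).
  { intros i j Hij; unfold delta; destruct (St (i, j)) eqn:E; [|reflexivity].
    exfalso; apply Hno; exists i, j; auto. }
  assert (Hnb : 0 < INR (nb_steps St)).
  { apply lt_0_INR; unfold nb_steps; destruct (has_east _ HM) as [j Hj].
    apply (step_list_In _ _ HM) in Hj; destruct (step_list St); [easy | simpl; lia]. }
  set (z := / INR (nb_steps St) / 2).
  assert (Hz0 : 0 < z < 1 / INR (nb_steps St)).
  { pose proof (Rinv_0_lt_compat _ Hnb); unfold z; lra. }
  destruct (initial_order _ _ _ _ _ hy z Hz0) as [r2 [r3 [E2 [E3 [_ [H2 [_ [H3 H4]]]]]]]].
  destruct (roots_d_tilde _ _ _ _ _ hy z ltac:(lra)) as [k [Hk Hd]].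
  set (q := fun y : C => ((delta St 0 0 + delta St 0 1 * y - / RtoC z) ^ 2
     - 4 * (delta St 1 (-1) + delta St 1 0 * y + delta St 1 1 * y ^ 2) * delta St (-1) 1)%C).
  assert (Hq : forall y, d_tilde St y z = (y ^ 2 * q y)%C).
  { intro y; unfold d_tilde, a_tilde, b_tilde, c_tilde, branch_coef, q.
    rewrite (Hz 0%Z (-1)%Z), (Hz (-1)%Z 0%Z), (Hz (-1)%Z (-1)%Z) by reflexivity.
    unfold Cdiv; ring. }
  assert (Hlf : last_factor y4 z (RtoC 0) <> RtoC 0).
  { destruct y4 as [f|]; simpl.
    - intro H; pose proof (H4 f eq_refl) as H5.
      replace (f z) with (RtoC 0 - (RtoC 0 - f z))%C in H5 by ring.
      rewrite H in H5; unfold Cminus in H5; rewrite Cplus_opp_r, Cmod_0 in H5; lra.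
    - intro H; apply RtoC_inj in H; lra. }
  assert (E1 : y1 z = RtoC 0).
  { pose proof (Hd (RtoC 0)) as H0; rewrite Hq in H0.
    assert (H : (k * (0 - y1 z) * (0 - y2 z) * (0 - y3 z) * last_factor y4 z 0)%C = RtoC 0)
      by (rewrite <- H0; ring).
    apply Cmult_integral in H as [H|H]; [|contradiction].
    apply Cmult_integral in H as [H|H].
    - apply Cmult_integral in H as [H|H].
      + apply Cmult_integral in H as [H|H]; [contradiction|].
        replace (y1 z) with (- (0 - y1 z))%C by ring; rewrite H; ring.
      + rewrite E2, <- RtoC_minus in H; apply RtoC_inj in H; lra.
    - rewrite E3, <- RtoC_minus in H; apply RtoC_inj in H; lra. }
  set (p := fun y : C => (k * (y - y2 z) * (y - y3 z) * last_factor y4 z y)%C).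
  assert (Hp : forall n : R, n <> 0 -> (p (RtoC n) = RtoC n * q (RtoC n))%C).
  { intros n Hn; pose proof (Hd (RtoC n)) as H; rewrite Hq, E1 in H.
    assert (HnC : RtoC n <> RtoC 0) by (intro E; apply RtoC_inj in E; lra).
    replace (p (RtoC n)) with (/ RtoC n *
      (k * (RtoC n - 0) * (RtoC n - y2 z) * (RtoC n - y3 z) * last_factor y4 z (RtoC n)))%C
      by (unfold p; field; assumption).
    rewrite <- H; field; assumption. }
  (* The fourth difference of the cubic y q(y) - p(y) vanishes, so p(0) = 0. *)
  assert (Hp0 : p (RtoC 0) = RtoC 0).
  { assert (Hdiff : p (RtoC 0) = (4 * p (RtoC 1) - 6 * p (RtoC 2) + 4 * p (RtoC 3) - p (RtoC 4))%C)
      by (unfold p; destruct y4; simpl; ring).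
    rewrite Hdiff, !Hp by lra; unfold q; ring. }
  unfold p in Hp0; apply Cmult_integral in Hp0 as [H|H]; [|contradiction].
  apply Cmult_integral in H as [H|H].
  - apply Cmult_integral in H as [H|H]; [contradiction|].
    rewrite E2, <- RtoC_minus in H; apply RtoC_inj in H; lra.
  - rewrite E3, <- RtoC_minus in H; apply RtoC_inj in H; lra.
Qed.

Lemma nb_steps_step_sum (St : Z * Z -> bool) : INR (nb_steps St) = step_sum St 0 0.
Proof.
  unfold nb_steps, step_sum.
  induction (step_list St) as [|s l IH]; [reflexivity|].
  cbn [length lsum fold_right]; rewrite S_INR, IH; unfold lsum, weight at 2.
  rewrite !Rmult_0_r, Rplus_0_l, exp_0; ring.
Qed.

(** By convexity phi is at most phi(0) between 0 and its minimiser, and phi(0) is at most the step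
    polynomial at (1, 1). *)
Lemma phi_le_nb_steps (St : Z * Z -> bool) (b0 t : R) :
  is_model St -> (forall b, phi St b0 <= phi St b) -> 0 <= t <= 1 ->
  phi St (t * b0) <= INR (nb_steps St).
Proof.
  intros HM Hmin Ht.
  pose proof (phi_convex St 0 b0 t HM Ht) as H.
  replace ((1 - t) * 0 + t * b0) with (t * b0) in H by ring.
  pose proof (phi_le_step_sum St 0 0 HM) as H0; rewrite <- nb_steps_step_sum in H0.
  pose proof (Hmin 0); nra.
Qed.

(** The given order places the roots around 1, whereas the argument needs them around exp b0. For
    small z no positive root lies between these two values, so the order carries over. *)
Lemma initial_circle (St : Z * Z -> bool) (b0 z b : R) :
  is_model St -> (forall b, phi St b0 <= phi St b) -> 0 < z < 1 / INR (nb_steps St) ->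
  0 <= b <= b0 \/ b0 <= b <= 0 -> d_tilde St (RtoC (exp b)) z <> RtoC 0.
Proof.
  intros HM Hmin Hz Hb.
  assert (Ht : exists t, 0 <= t <= 1 /\ b = t * b0).
  { destruct (Req_dec b0 0) as [E|Hn]; [exists 0; split; lra|].
    exists (b / b0); split; [|field; lra].
    destruct Hb as [Hb|Hb].
    - split; [apply Rmult_le_pos; [lra | left; apply Rinv_0_lt_compat; lra]|].
      apply Rmult_le_reg_r with b0; [lra|]; field_simplify; lra.
    - replace (b / b0) with (- b / - b0) by (field; lra).
      split; [apply Rmult_le_pos; [lra | left; apply Rinv_0_lt_compat; lra]|].
      apply Rmult_le_reg_r with (- b0); [lra|]; field_simplify; lra. }
  destruct Ht as [t [Ht ->]].
  apply circle_no_root with (t * b0); [lra | |].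
  - eapply Rle_lt_trans; [now apply phi_le_nb_steps|].
    assert (Hn : 0 < INR (nb_steps St)).
    { pose proof (phi_le_nb_steps St b0 0 HM Hmin ltac:(lra)).
      pose proof (phi_pos St (0 * b0) HM); lra. }
    rewrite <- (Rinv_inv (INR (nb_steps St))).
    apply Rinv_lt_contravar; [|lra].
    apply Rmult_lt_0_compat; [lra | now apply Rinv_0_lt_compat].
  - rewrite Cmod_R, Rabs_pos_eq; [reflexivity | left; apply exp_pos].
Qed.

Lemma initial_separation (St : Z * Z -> bool) (y1 y2 y3 : R -> C) (y4 : option (R -> C))
    (b0 z : R) :
  is_model St -> branch_points St y1 y2 y3 y4 -> (forall b, phi St b0 <= phi St b) ->
  0 < z < 1 / INR (nb_steps St) ->
  exists b2 b3, y2 z = RtoC (exp b2) /\ y3 z = RtoC (exp b3) /\ b2 < b0 < b3 /\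
    Cmod (y1 z) <= exp b2 /\ (forall f, y4 = Some f -> exp b3 <= Cmod (f z)).
Proof.
  intros HM hy Hmin Hz.
  destruct (initial_order _ _ _ _ _ hy z Hz)
    as [r2 [r3 [E2 [E3 [H1 [H2 [H2' [H3 H4]]]]]]]].
  exists (ln r2), (ln r3); rewrite !exp_ln by lra.
  assert (L2 : ln r2 < 0) by (rewrite <- ln_1; apply ln_increasing; lra).
  assert (L3 : 0 < ln r3) by (rewrite <- ln_1; apply ln_increasing; lra).
  repeat split; auto.
  - destruct (Rlt_le_dec (ln r2) b0) as [|Hle]; [assumption|exfalso].
    apply (initial_circle St b0 z (ln r2) HM Hmin Hz); [lra|].
    rewrite exp_ln by assumption; apply (d_tilde_root_iff _ _ _ _ _ z _ hy); [lra | auto].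
  - destruct (Rlt_le_dec b0 (ln r3)) as [|Hle]; [assumption|exfalso].
    apply (initial_circle St b0 z (ln r3) HM Hmin Hz); [lra|].
    rewrite exp_ln by lra; apply (d_tilde_root_iff _ _ _ _ _ z _ hy); [lra | auto].
Qed.

Lemma circle_side (St : Z * Z -> bool) (b0 : R) (f : R -> C) (z0 z : R) :
  is_model St -> (forall z, 0 < z -> continuous f z) ->
  (forall z, 0 < z -> d_tilde St (f z) z = RtoC 0) ->
  0 < z0 < / phi St b0 -> 0 < z < / phi St b0 ->
  (Cmod (f z0) < exp b0 -> Cmod (f z) < exp b0) /\
  (exp b0 < Cmod (f z0) -> exp b0 < Cmod (f z)).
Proof.
  intros HM Hf Hroot Hz0 Hz.
  pose proof (phi_pos St b0 HM) as Hphi.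
  assert (Hne : forall t, 0 < t < / phi St b0 -> Cmod (f t) <> exp b0).
  { intros t Ht E; apply (circle_no_root St b0 t (f t)); [lra | | assumption | apply Hroot; lra].
    rewrite <- (Rinv_inv (phi St b0)); apply Rinv_lt_contravar; [|lra].
    apply Rmult_lt_0_compat; lra. }
  assert (Hc : forall t, 0 < t < / phi St b0 -> continuous (fun t => Cmod (f t)) t).
  { intros t Ht; apply continuous_Cmod, Hf; lra. }
  split; intro H.
  - enough (Cmod (f z) - exp b0 < 0) by lra.
    apply (no_zero_sign (fun t => Cmod (f t) - exp b0) 0 (/ phi St b0) z0); auto; try lra.
    + intros t Ht; apply (continuous_minus (V := R_NormedModule));
        [auto | apply continuous_const].
    + intros t Ht E; apply (Hne t Ht); lra.
  - enough (exp b0 - Cmod (f z) < 0) by lra.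
    apply (no_zero_sign (fun t => exp b0 - Cmod (f t)) 0 (/ phi St b0) z0); auto; try lra.
    + intros t Ht; apply (continuous_minus (V := R_NormedModule));
        [apply continuous_const | auto].
    + intros t Ht E; apply (Hne t Ht); lra.
Qed.

Lemma nb_steps_inv_le (St : Z * Z -> bool) (b0 : R) :
  is_model St -> (forall b, phi St b0 <= phi St b) ->
  0 < 1 / INR (nb_steps St) <= / phi St b0.
Proof.
  intros HM Hmin.
  pose proof (phi_le_nb_steps St b0 1 HM Hmin ltac:(lra)) as H; rewrite Rmult_1_l in H.
  pose proof (phi_pos St b0 HM).
  unfold Rdiv; rewrite Rmult_1_l; split; [apply Rinv_0_lt_compat; lra|].
  apply Rinv_le_contravar; lra.
Qed.

Lemma phi_inv_lt_nb_steps (St : Z * Z -> bool) (b0 b : R) :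
  is_model St -> (forall b, phi St b0 <= phi St b) -> INR (nb_steps St) < phi St b ->
  0 < / phi St b < 1 / INR (nb_steps St).
Proof.
  intros HM Hmin Hb.
  pose proof (phi_le_nb_steps St b0 1 HM Hmin ltac:(lra)) as H; rewrite Rmult_1_l in H.
  pose proof (phi_pos St b0 HM).
  unfold Rdiv; rewrite Rmult_1_l; split; [apply Rinv_0_lt_compat; lra|].
  apply Rinv_lt_contravar; [apply Rmult_lt_0_compat; lra | assumption].
Qed.

Lemma circle_separation (St : Z * Z -> bool) (y1 y2 y3 : R -> C) (y4 : option (R -> C))
    (b0 z : R) :
  is_model St -> branch_points St y1 y2 y3 y4 -> (forall b, phi St b0 <= phi St b) ->
  0 < z < / phi St b0 ->
  Cmod (y1 z) < exp b0 /\ Cmod (y2 z) < exp b0 /\ exp b0 < Cmod (y3 z) /\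
  (forall f, y4 = Some f -> exp b0 < Cmod (f z)).
Proof.
  intros HM hy Hmin Hz.
  pose proof (nb_steps_inv_le St b0 HM Hmin) as Hn.
  set (z0 := 1 / INR (nb_steps St) / 2).
  assert (Hz0 : 0 < z0 < 1 / INR (nb_steps St)) by (unfold z0; lra).
  destruct (initial_separation _ _ _ _ _ b0 z0 HM hy Hmin Hz0)
    as [b2 [b3 [E2 [E3 [[Hb2 Hb3] [H1 H4]]]]]].
  apply exp_increasing in Hb2, Hb3.
  assert (Hr : forall f, (forall z, 0 < z -> f z = y1 z \/ f z = y2 z \/ f z = y3 z \/
    exists g, y4 = Some g /\ f z = g z) -> forall z, 0 < z -> d_tilde St (f z) z = RtoC 0).
  { intros f Hf t Ht; apply (d_tilde_root_iff _ _ _ _ _ t _ hy Ht), Hf, Ht. }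
  repeat split.
  - apply (circle_side St b0 y1 z0 z HM (continuous_y1 _ _ _ _ _ hy)); try lra.
    apply Hr; auto.
  - apply (circle_side St b0 y2 z0 z HM (continuous_y2 _ _ _ _ _ hy)); try lra.
    + apply Hr; auto.
    + rewrite E2, Cmod_R, Rabs_pos_eq; [lra | left; apply exp_pos].
  - apply (circle_side St b0 y3 z0 z HM (continuous_y3 _ _ _ _ _ hy)); try lra.
    + apply Hr; auto.
    + rewrite E3, Cmod_R, Rabs_pos_eq; [lra | left; apply exp_pos].
  - intros f Hf; specialize (H4 f Hf).
    apply (circle_side St b0 f z0 z HM (continuous_y4 _ _ _ _ _ hy f Hf)); try lra.
    apply Hr; eauto 8.
Qed.

(** Far enough along either ray, z = 1/phi drops below 1/|S|, where [initial_order] names the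
    roots. *)
Lemma phi_unbounded (St : Z * Z -> bool) (b0 e : R) :
  is_model St -> straddles (step_list St) 1 = true ->
  straddles (step_list St) (-1) = true -> e = 1 \/ e = -1 ->
  exists T, 0 < T /\ INR (nb_steps St) < phi St (b0 + e * T).
Proof.
  intros HM H1 H2 He.
  pose proof (pos_INR (nb_steps St)) as Hn; pose proof (Rabs_pos b0) as Hb.
  pose proof (Rle_abs b0); pose proof (Rle_abs (- b0)); rewrite Rabs_Ropp in *.
  set (T := Rabs b0 + 2 * INR (nb_steps St) + 1).
  exists T; split; [unfold T; lra|].
  assert (Hx : INR (nb_steps St) + / 2 <= (e * (b0 + e * T)) / 2).
  { destruct He as [-> | ->]; unfold T; lra. }
  pose proof (exp_ineq1_le ((e * (b0 + e * T)) / 2)).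
  assert (exp ((e * (b0 + e * T)) / 2) <= phi St (b0 + e * T)); [|lra].
  destruct He as [-> | ->].
  - apply (straddles_bound St 1); auto; lra.
  - apply (straddles_bound St (-1)); auto; lra.
Qed.

Lemma Cmod_linear_bound (c : C) (B y : R) :
  Rabs y <= B -> Cmod (RtoC y - c)%C <= B + Cmod c.
Proof.
  intro H; eapply Rle_trans; [apply Cmod_triangle|].
  rewrite Cmod_opp, Cmod_R; lra.
Qed.

Lemma Cmod_quadratic_bound (k c1 c2 : C) (B : R) :
  exists M, forall y : R, Rabs y <= B ->
    Cmod (k * (RtoC y - c1) * (RtoC y - c2))%C <= M.
Proof.
  exists (Cmod k * (B + Cmod c1) * (B + Cmod c2)); intros y Hy.
  rewrite !Cmod_mult.
  apply Rmult_le_compat; [apply Rmult_le_pos; apply Cmod_ge_0 | apply Cmod_ge_0 | |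
    now apply Cmod_linear_bound].
  apply Rmult_le_compat; try apply Cmod_ge_0; [lra | now apply Cmod_linear_bound].
Qed.

(** On the left curve the root exp(b0 - t) is inside the separating circle, so it is [y1] or [y2],
    and not both by [no_double_root]; [branch_tracking] carries the label from a far T to the
    merging point. *)
Lemma y2_at_merge (St : Z * Z -> bool) (y1 y2 y3 : R -> C) (y4 : option (R -> C)) (b0 : R) :
  is_model St -> branch_points St y1 y2 y3 y4 ->
  straddles (step_list St) 1 = true -> straddles (step_list St) (-1) = true ->
  (forall b, phi St b0 <= phi St b) -> y2 (/ phi St b0) = RtoC (exp b0).
Proof.
  intros HM hy S1 S2 Hmin.
  assert (Hlt : forall t, 0 < t -> 0 < / phi St (b0 + -1 * t) < / phi St b0).
  { intros t Ht; pose proof (phi_pos St b0 HM).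
    pose proof (phi_strict_minimum St b0 (b0 + -1 * t) HM S1 Hmin ltac:(lra)).
    split; [apply Rinv_0_lt_compat; lra|].
    apply Rinv_lt_contravar; [apply Rmult_lt_0_compat; lra | assumption]. }
  assert (Hroot : forall t, 0 < t ->
    d_tilde St (RtoC (exp (b0 + -1 * t))) (/ phi St (b0 + -1 * t)) = RtoC 0).
  { intros t Ht; apply discriminant_zero; [now apply Hlt | apply Rinv_inv]. }
  assert (Hor : forall t, 0 < t ->
    RtoC (exp (b0 + -1 * t)) = y2 (/ phi St (b0 + -1 * t)) \/
    RtoC (exp (b0 + -1 * t)) = y1 (/ phi St (b0 + -1 * t))).
  { intros t Ht.
    destruct (circle_separation _ _ _ _ _ b0 _ HM hy Hmin (Hlt t Ht)) as [_ [_ [C3 C4]]].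
    assert (He : Cmod (RtoC (exp (b0 + -1 * t))) < exp b0).
    { rewrite Cmod_R, Rabs_pos_eq by (left; apply exp_pos); apply exp_increasing; lra. }
    destruct (proj1 (d_tilde_root_iff _ _ _ _ _ _ _ hy (proj1 (Hlt t Ht))) (Hroot t Ht)) as [E|[E|[E|[f [Ef E]]]]]; auto; exfalso; rewrite E in He.
    - lra.
    - specialize (C4 f Ef); lra. }
  destruct (phi_unbounded St b0 (-1) HM S1 S2 (or_intror eq_refl)) as [T [HT HTn]].
  apply (branch_tracking St b0 (-1) T y2 y1 HM); auto.
  - apply (continuous_y2 _ _ _ _ _ hy).
  - apply (continuous_y1 _ _ _ _ _ hy).
  - intros t Ht E2 E1.
    destruct (roots_d_tilde _ _ _ _ _ hy _ (proj1 (Hlt t Ht))) as [k [_ Hk]].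
    apply (no_double_root St b0 (b0 + -1 * t)
      (fun y => k * (y - y3 (/ phi St (b0 + -1 * t))%R)
                  * last_factor y4 (/ phi St (b0 + -1 * t))%R y)%C); auto; [lra | |].
    + intro y; rewrite Hk, <- E1, <- E2; ring.
    + intro B; destruct y4 as [f|]; simpl; [apply Cmod_quadratic_bound|].
      exists (Cmod k * (B + Cmod (y3 (/ phi St (b0 + -1 * t))))); intros y Hy.
      rewrite Cmult_1_r, Cmod_mult.
      apply Rmult_le_compat_l; [apply Cmod_ge_0 | now apply Cmod_linear_bound].
  (* If the root at T is [y1], then |y1| <= y2 puts [y2] either at the same place or strictly
     between it and exp b0, where there is no root. *)
  - destruct (Hor T HT) as [E|E]; [assumption|].
    set (z := / phi St (b0 + -1 * T)) in *.
    assert (Hz : 0 < z < 1 / INR (nb_steps St)) by now apply (phi_inv_lt_nb_steps St b0).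
    destruct (initial_separation _ _ _ _ _ b0 z HM hy Hmin Hz)
      as [b2 [b3 [E2 [_ [[Hb2 _] [H1 _]]]]]].
    rewrite <- E, Cmod_R, Rabs_pos_eq in H1 by (left; apply exp_pos).
    rewrite E2; destruct (Req_dec b2 (b0 + -1 * T)) as [->|Hne]; [reflexivity|exfalso].
    assert (Hlow : b0 + -1 * T < b2).
    { destruct (Rlt_le_dec (b0 + -1 * T) b2) as [|Hle]; [assumption|exfalso].
      assert (b2 < b0 + -1 * T) as Hb by lra; apply exp_increasing in Hb; lra. }
    apply (no_root_between St b0 (b0 + -1 * T) b2 HM S1 Hmin); [lra|].
    apply (d_tilde_root_iff _ _ _ _ _ _ _ hy); [apply Hz | right; left; now symmetry].
Qed.

(** Mirror image of [y2_at_merge]: the competitor outside the circle is [y4], and y3 <= |y4| selects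
    [y3] at the far end. *)
Lemma y3_at_merge (St : Z * Z -> bool) (y1 y2 y3 : R -> C) (y4 : option (R -> C)) (b0 : R) :
  is_model St -> branch_points St y1 y2 y3 y4 ->
  straddles (step_list St) 1 = true -> straddles (step_list St) (-1) = true ->
  (forall b, phi St b0 <= phi St b) -> y3 (/ phi St b0) = RtoC (exp b0).
Proof.
  intros HM hy S1 S2 Hmin.
  assert (Hlt : forall t, 0 < t -> 0 < / phi St (b0 + 1 * t) < / phi St b0).
  { intros t Ht; pose proof (phi_pos St b0 HM).
    pose proof (phi_strict_minimum St b0 (b0 + 1 * t) HM S1 Hmin ltac:(lra)).
    split; [apply Rinv_0_lt_compat; lra|].
    apply Rinv_lt_contravar; [apply Rmult_lt_0_compat; lra | assumption]. }
  assert (Hroot : forall t, 0 < t ->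
    d_tilde St (RtoC (exp (b0 + 1 * t))) (/ phi St (b0 + 1 * t)) = RtoC 0).
  { intros t Ht; apply discriminant_zero; [now apply Hlt | apply Rinv_inv]. }
  (* When the fourth root is infinite, the constant 0 stands in for it. *)
  set (g := match y4 with Some f => f | None => fun _ => RtoC 0 end).
  assert (Hexp0 : forall b, RtoC (exp b) <> RtoC 0).
  { intros b E; apply RtoC_inj in E; pose proof (exp_pos b); lra. }
  assert (Hor : forall t, 0 < t ->
    RtoC (exp (b0 + 1 * t)) = y3 (/ phi St (b0 + 1 * t)) \/
    RtoC (exp (b0 + 1 * t)) = g (/ phi St (b0 + 1 * t))).
  { intros t Ht.
    destruct (circle_separation _ _ _ _ _ b0 _ HM hy Hmin (Hlt t Ht)) as [C1 [C2 _]].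
    assert (He : exp b0 < Cmod (RtoC (exp (b0 + 1 * t)))).
    { rewrite Cmod_R, Rabs_pos_eq by (left; apply exp_pos); apply exp_increasing; lra. }
    destruct (proj1 (d_tilde_root_iff _ _ _ _ _ _ _ hy (proj1 (Hlt t Ht))) (Hroot t Ht)) as [E|[E|[E|[f [Ef E]]]]]; auto.
    - exfalso; rewrite E in He; lra.
    - exfalso; rewrite E in He; lra.
    - right; unfold g; now rewrite Ef. }
  destruct (phi_unbounded St b0 1 HM S1 S2 (or_introl eq_refl)) as [T [HT HTn]].
  apply (branch_tracking St b0 1 T y3 g HM); auto.
  - apply (continuous_y3 _ _ _ _ _ hy).
  - unfold g; destruct y4 as [f|] eqn:E4.
    + apply (continuous_y4 _ _ _ _ _ hy f eq_refl).
    + intros; apply continuous_const.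
  - intros t Ht E3 E4.
    destruct (roots_d_tilde _ _ _ _ _ hy _ (proj1 (Hlt t Ht))) as [k [_ Hk]].
    unfold g in E4; destruct y4 as [f|]; [|now apply Hexp0 in E4].
    apply (no_double_root St b0 (b0 + 1 * t)
      (fun y => k * (y - y1 (/ phi St (b0 + 1 * t))%R)
                  * (y - y2 (/ phi St (b0 + 1 * t))%R))%C); auto; [lra | |].
    + intro y; rewrite Hk; simpl; rewrite <- E3, <- E4; ring.
    + intro B; apply Cmod_quadratic_bound.
  - destruct (Hor T HT) as [E|E]; [assumption|].
    unfold g in E; destruct y4 as [f|] eqn:E4; [|now apply Hexp0 in E].
    set (z := / phi St (b0 + 1 * T)) in *.
    assert (Hz : 0 < z < 1 / INR (nb_steps St)) by now apply (phi_inv_lt_nb_steps St b0).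
    destruct (initial_separation _ _ _ _ _ b0 z HM hy Hmin Hz)
      as [b2 [b3 [_ [E3 [[_ Hb3] [_ H4]]]]]].
    specialize (H4 f eq_refl).
    rewrite <- E, Cmod_R, Rabs_pos_eq in H4 by (left; apply exp_pos).
    rewrite E3; destruct (Req_dec b3 (b0 + 1 * T)) as [->|Hne]; [reflexivity|exfalso].
    assert (Hlow : b3 < b0 + 1 * T).
    { destruct (Rlt_le_dec b3 (b0 + 1 * T)) as [|Hle]; [assumption|exfalso].
      assert (b0 + 1 * T < b3) as Hb by lra; apply exp_increasing in Hb; lra. }
    apply (no_root_between St b0 (b0 + 1 * T) b3 HM S1 Hmin); [lra|].
    apply (d_tilde_root_iff _ _ _ _ _ _ _ hy); [apply Hz | right; right; left; now symmetry].
Qed.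

Lemma excursion_radius (St : Z * Z -> bool) (b0 : R) :
  is_model St -> (exists i j, St (i, j) = true /\ (i + j < 0)%Z) ->
  (forall b, phi St b0 <= phi St b) ->
  (forall x, 0 < x < / phi St b0 -> ex_series (fun n => INR (q00 St n) * x ^ n)) /\
  (forall x, / phi St b0 < x -> ~ ex_series (fun n => INR (q00 St n) * x ^ n)).
Proof.
  intros HM Hneg Hmin.
  pose proof (phi_pos St b0 HM) as Hphi.
  pose proof (phi_attained St b0 HM) as E; set (a := phi_arg St b0) in E; unfold step_sum in E.
  set (L := step_list St) in *.
  assert (HL : forall s, In s L -> (-1 <= fst s <= 1 /\ -1 <= snd s <= 1)%Z)
    by (intros; now apply (step_list_small St)).
  split; intros x Hx.
  - apply (@ex_series_le R_AbsRing R_CompleteNormedModule _ (fun n => (phi St b0 * x) ^ n)).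
    + intro n; change (Rabs (INR (q00 St n) * x ^ n) <= (phi St b0 * x) ^ n).
      assert (Hxn : 0 <= x ^ n) by (apply pow_le; lra).
      rewrite Rabs_pos_eq by (apply Rmult_le_pos; [apply pos_INR | assumption]).
      rewrite Rpow_mult_distr; apply Rmult_le_compat_r; [assumption|].
      pose proof (nb_returns_le L a b0 n 0 0) as H; rewrite E in H.
      unfold weight in H; simpl in H.
      rewrite !Rmult_0_l, Rplus_0_l, exp_0, Rmult_1_r in H; exact H.
    + apply ex_series_geom.
      rewrite Rabs_pos_eq by (apply Rmult_le_pos; lra).
      rewrite <- (Rinv_r (phi St b0)) by lra; apply Rmult_lt_compat_l; lra.
  - destruct (minimum_drift_zero L a b0 HL) as [D1 D2].
    { intros a' b'; rewrite E; eapply Rle_trans; [apply Hmin|].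
      now apply (phi_le_step_sum St). }
    pose proof (model_facts_hold St HM Hneg) as HF.
    destruct (step_basis_exists L HL HF) as [l [e [f HB]]].
    pose proof (Rinv_0_lt_compat _ Hphi).
    apply (returns_diverge L l e f a b0 x HB HL); auto; try lra.
    + destruct (has_east _ HM) as [j Hj]; exists j; now apply step_list_In.
    + destruct (has_west _ HM) as [j Hj]; exists j; now apply step_list_In.
    + destruct (has_north _ HM) as [j Hj]; exists j; now apply step_list_In.
    + destruct (has_south _ HM) as [j Hj]; exists j; now apply step_list_In.
    + destruct (leaves_origin _ HM) as [H'|[H'|H']];
        apply (step_list_In _ _ HM) in H'; auto.
    (* For small steps i + j < 0 leaves only the three steps that can end a walk at the origin from
       deep inside. *)
    + destruct Hneg as [i [j [Hs Hij]]]; apply (step_list_In _ _ HM) in Hs; fold L in Hs.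
      pose proof (HL _ Hs) as HB'; simpl in HB'.
      assert ((i = -1 /\ j = 0) \/ (i = 0 /\ j = -1) \/ (i = -1 /\ j = -1))%Z as
        [[-> ->]|[[-> ->]|[-> ->]]] by lia; auto.
    + rewrite E, <- (Rinv_l (phi St b0)) by lra; apply Rmult_lt_compat_r; lra.
Qed.

Theorem proposition4p4
    (St : Z * Z -> bool) (hSt : is_model St)
    (y1 y2 y3 : R -> C) (y4 : option (R -> C))
    (hy : branch_points St y1 y2 y3 y4) :
  exists zg : R,
    is_glb_Rbar (fun z : R => (0 < z)%R /\ y2 z = y3 z) (Finite zg) /\
    smallest_positive_singularity (fun n => RtoC (INR (q00 St n))) zg.
Proof.
  pose proof (negative_step St y1 y2 y3 y4 hSt hy) as Hneg.
  pose proof (model_facts_hold St hSt Hneg) as HF.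
  unfold model_facts in HF.
  apply andb_prop in HF as [HF S2]; apply andb_prop in HF as [_ S1].
  destruct (phi_minimum St hSt S1 S2) as [b0 Hmin].
  pose proof (Rinv_0_lt_compat _ (phi_pos St b0 hSt)) as Hzg.
  exists (/ phi St b0); split; [split|].
  - intros z [Hz E]; simpl.
    destruct (Rle_lt_dec (/ phi St b0) z) as [|Hlt]; [assumption|exfalso].
    destruct (circle_separation _ _ _ _ _ b0 z hSt hy Hmin (conj Hz Hlt)) as [_ [C2 [C3 _]]].
    rewrite E in C2; lra.
  - intros l Hl; apply (Hl (/ phi St b0)); split; [assumption|].
    now rewrite (y2_at_merge St y1 y2 y3 y4 b0), (y3_at_merge St y1 y2 y3 y4 b0).
  - destruct (excursion_radius St b0 hSt Hneg Hmin) as [Hin Hout].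
    apply (vivanti_pringsheim (fun n => INR (q00 St n))); auto.
    intro n; apply pos_INR.
Qed.
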